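(* Let $R$ be an integral domain which is a finite type algebra over an algebraically closed field, and let $A$ be an $R$-algebra that is finitely generated and flat as an $R$-module. Let $X$ be the set of closed points of $\operatorname{Spec}(R)$. Then the map $X\to\mathbb{N}$, $\mathfrak{m}\mapsto\#\mathrm{Bl}(A(\mathfrak{m}))$, is lower semicontinuous. In particular, $X$ admits a stratification according to the number of blocks of the fibers of $A$ over $X$, namely $X=\coprod_{n\in\mathbb{N}}\{\mathfrak{m}\in X\mid\#\mathrm{Bl}(A(\mathfrak{m}))=n\}$.
   Context: The set $X$ carries the subspace topology from $\operatorname{Spec}(R)$. $\mathrm{Bl}(B)$ denotes the set of block idempotents (centrally-primitive idempotents) of a ring $B$; its cardinality is the number of blocks of $B$. For $\mathfrak{m}\in X$, $A(\mathfrak{m})=(R/\mathfrak{m})\otimes_R A=A/\mathfrak{m}A$ is the fiber of $A$ in $\mathfrak{m}$. Lower semicontinuous means that $\{\mathfrak{m}\in X\mid\#\mathrm{Bl}(A(\mathfrak{m}))\leq n\}$ is closed in $X$ for all $n$. ''Stratification'' means that the pieces are locally closed in $X$ and that the closure in $X$ of the piece with value $n$ is contained in the union of the pieces with values $m\leq n$. The generic fiber of $A$ is not assumed to be split. *)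

(* Defs.v *)
From HB Require Import structures.
From mathcomp Require Import all_boot all_order all_algebra finmap.
From mathcomp Require Import boolp classical_sets cardinality topology.
(* Not imported: its notations clash with those of MathComp-Analysis. *)
From mathcomp Require mpoly.

Set Implicit Arguments.
Unset Strict Implicit.
Unset Printing Implicit Defensive.

Import GRing.Theory.

Local Open Scope classical_set_scope.
Local Open Scope ring_scope.
Local Open Scope quotient_scope.

(* An R-algebra is a ring A with a morphism from R to the center of A.  MathComp's
   [algType R] would exclude A = 0. *)
Record alg_structure (R : comNzRingType) (A : pzRingType) := AlgStructure {
  alg_morph :> {rmorphism R -> A};
  alg_central : forall r a, alg_morph r * a = a * alg_morph r
}.

Definition alg_module (R : comNzRingType) (A : pzRingType)
  (alpha : alg_structure R A) : Type := A.

Section AlgModule.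
Variables (R : comNzRingType) (A : pzRingType) (alpha : alg_structure R A).

HB.instance Definition _ := GRing.PzRing.on (alg_module alpha).

Let ascale (r : R) (a : alg_module alpha) : alg_module alpha := alpha r * a.
Let ascaleA r s a : ascale r (ascale s a) = ascale (r * s) a.
Proof. by rewrite /ascale rmorphM mulrA. Qed.
Let ascale1 : left_id 1 ascale.
Proof. by move=> a; rewrite /ascale rmorph1 mul1r. Qed.
Let ascaleDr : right_distributive ascale +%R.
Proof. by move=> r a b; rewrite /ascale mulrDr. Qed.
Let ascaleDl a : {morph ascale^~ a : r s / r + s}.
Proof. by move=> r s; rewrite /ascale rmorphD mulrDl. Qed.

HB.instance Definition _ := GRing.Zmodule_isLmodule.Build R (alg_module alpha)
  ascaleA ascale1 ascaleDr ascaleDl.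

Lemma alg_scaleE r (a : alg_module alpha) : r *: a = (alpha r * (a : A) : A).
Proof. by []. Qed.

End AlgModule.

Definition finite_type (k R : comNzRingType) (iota : {rmorphism k -> R}) :=
  exists (n : nat) (x : 'I_n -> R),
    forall r, exists p : mpoly.mpoly n k, r = mpoly.mmap iota x p.

Section Modules.
Variable R : comNzRingType.
Implicit Types M N T : lmodType R.

Definition finitely_generated M :=
  exists (n : nat) (a : 'I_n -> M),
    forall x, exists c : 'I_n -> R, x = \sum_(i < n) c i *: a i.

Definition is_tensor M N T (t : {bilinear M -> N -> T}) :=
  forall (L : lmodType R) (b : {bilinear M -> N -> L}),
    exists g : {linear T -> L},
      (forall x y, g (t x y) = b x y) /\
      (forall h : {linear T -> L}, (forall x y, h (t x y) = b x y) -> h =1 g).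

(* The functor M (x) - preserves injections; g is the map id (x) f.  Tensor
   products exist by [tensorP] below. *)
Definition flat M :=
  forall (N N' T T' : lmodType R)
    (t : {bilinear M -> N -> T}) (t' : {bilinear M -> N' -> T'}),
    is_tensor t -> is_tensor t' ->
  forall (f : {linear N -> N'}) (g : {linear T -> T'}),
    (forall x y, g (t x y) = t' x (f y)) -> injective f -> injective g.

End Modules.

(* Existence of tensor products: finite formal sums of pure tensors, two of them
   being identified when no bilinear map separates them. *)
Section Tensor.
Variables (R : comNzRingType) (M N : lmodType R).

Definition bilsum (L : lmodType R) (b : {bilinear M -> N -> L})
  (s : seq (M * N)) : L := \sum_(p <- s) b p.1 p.2.

Definition teq (s s' : seq (M * N)) : bool :=
  `[< forall (L : lmodType R) (b : {bilinear M -> N -> L}),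
        bilsum b s = bilsum b s' >].

Lemma teqP s s' : reflect (forall (L : lmodType R) (b : {bilinear M -> N -> L}),
  bilsum b s = bilsum b s') (teq s s').
Proof. exact: asboolP. Qed.

Lemma teq_equiv : equiv_class_of teq.
Proof.
split=> [s|s s'|s s' s'']; first exact/teqP.
  by apply/teqP/teqP => h L b; rewrite h.
by move=> /teqP h /teqP h'; apply/teqP => L b; rewrite h h'.
Qed.

Canonical teq_equivRel := EquivRelPack teq_equiv.
Canonical teq_encModRel := defaultEncModRel teq.

Definition tensor := {eq_quot teq}.
HB.instance Definition _ : EqQuotient _ teq tensor := EqQuotient.on tensor.
HB.instance Definition _ := Choice.on tensor.

Let scale_formal (r : R) (s : seq (M * N)) := [seq (r *: p.1, p.2) | p <- s].

Lemma bilsum_cat (L : lmodType R) (b : {bilinear M -> N -> L}) s s' :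
  bilsum b (s ++ s') = bilsum b s + bilsum b s'.
Proof. by rewrite /bilsum big_cat. Qed.

Lemma bilsum_scale (L : lmodType R) (b : {bilinear M -> N -> L}) r s :
  bilsum b (scale_formal r s) = r *: bilsum b s.
Proof.
rewrite /bilsum big_map scaler_sumr; apply: eq_bigr => p _ /=.
by rewrite linearZl.
Qed.

Lemma teq_pi s s' : (\pi_tensor s = \pi_tensor s') <->
  forall (L : lmodType R) (b : {bilinear M -> N -> L}), bilsum b s = bilsum b s'.
Proof. by split=> [/eqmodP/teqP|h]; last exact/eqmodP/teqP. Qed.

Lemma bilsum_repr (L : lmodType R) (b : {bilinear M -> N -> L}) s :
  bilsum b (repr (\pi_tensor s)) = bilsum b s.
Proof. by move: L b; apply/teq_pi; rewrite reprK. Qed.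

Let tzero : tensor := \pi_tensor [::].
Let tadd (u v : tensor) : tensor := \pi_tensor (repr u ++ repr v).
Let topp (u : tensor) : tensor := \pi_tensor (scale_formal (-1) (repr u)).
Let tscale (r : R) (u : tensor) : tensor := \pi_tensor (scale_formal r (repr u)).

Let bil0 (L : lmodType R) (b : {bilinear M -> N -> L}) : bilsum b [::] = 0.
Proof. exact: big_nil. Qed.

Let tE (u v : tensor) :
  (forall (L : lmodType R) (b : {bilinear M -> N -> L}),
     bilsum b (repr u) = bilsum b (repr v)) -> u = v.
Proof. by move=> h; rewrite -[u]reprK -[v]reprK; apply/teq_pi. Qed.

Let bilE := (bilsum_repr, bilsum_cat, bilsum_scale, bil0).

Let taddA : associative tadd.
Proof. by move=> u v w; apply: tE => L b; rewrite !bilE addrA. Qed.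
Let taddC : commutative tadd.
Proof. by move=> u v; apply: tE => L b; rewrite !bilE addrC. Qed.
Let tadd0 : left_id tzero tadd.
Proof. by move=> u; apply: tE => L b; rewrite !bilE add0r. Qed.
Let taddN : left_inverse tzero topp tadd.
Proof. by move=> u; apply: tE => L b; rewrite !bilE scaleN1r addNr. Qed.

HB.instance Definition _ :=
  GRing.isZmodule.Build tensor taddA taddC tadd0 taddN.

Let tscaleA a b u : tscale a (tscale b u) = tscale (a * b) u.
Proof. by apply: tE => L f; rewrite !bilE scalerA. Qed.
Let tscale1 : left_id 1 tscale.
Proof. by move=> u; apply: tE => L b; rewrite !bilE scale1r. Qed.
Let tscaleDr : right_distributive tscale +%R.
Proof. by move=> a u v; apply: tE => L b; rewrite !bilE scalerDr. Qed.
Let tscaleDl u : {morph tscale^~ u : a b / a + b}.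
Proof. by move=> a b; apply: tE => L f; rewrite !bilE scalerDl. Qed.

HB.instance Definition _ :=
  GRing.Zmodule_isLmodule.Build R tensor tscaleA tscale1 tscaleDr tscaleDl.

Definition tens (x : M) (y : N) : tensor := \pi_tensor [:: (x, y)].

Let bil1 (L : lmodType R) (b : {bilinear M -> N -> L}) x y :
  bilsum b [:: (x, y)] = b x y.
Proof. by rewrite /bilsum big_seq1. Qed.

Let tens_bilinear : bilinear_for *:%R *:%R tens.
Proof.
split=> z r x y; apply: tE => L b; rewrite !bilE !bil1.
  by rewrite linearPl.
by rewrite linearPr.
Qed.

HB.instance Definition _ :=
  bilinear_isBilinear.Build R M N tensor *:%R *:%R tens tens_bilinear.

Lemma tensor_sum (u : tensor) : u = \sum_(p <- repr u) tens p.1 p.2.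
Proof.
rewrite -[LHS]reprK; elim: (repr u) => [|[x y] s IHs].
  by rewrite big_nil.
rewrite big_cons -IHs; apply: tE => L b.
by rewrite !bilE -cat1s bilsum_cat.
Qed.

Lemma tensorP : is_tensor tens.
Proof.
move=> L b; pose g (u : tensor) := bilsum b (repr u).
have g_lin : linear g by move=> r u v; rewrite /g !bilE.
pose gL := GRing.isLinear.Build R tensor L *:%R g g_lin.
pose G : {linear tensor -> L} := HB.pack g gL.
exists G; split=> [x y|h hE u]; first by rewrite /= /g !bilE bil1.
rewrite [in LHS](tensor_sum u) linear_sum /=.
by apply: eq_bigr => p _; rewrite hE.
Qed.

End Tensor.

Definition Spec (R : comNzRingType) := prime_idealr R.

HB.instance Definition _ R := gen_eqMixin (Spec R).
HB.instance Definition _ R := gen_choiceMixin (Spec R).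

Section Zariski.
Variable R : comNzRingType.

Definition zero_locus (S : set R) : set (Spec R) :=
  [set p : Spec R | forall r, S r -> r \in (p : prime_idealr R)].

Definition zariski_open (U : set (Spec R)) :=
  exists S : set R, U = ~` zero_locus S.

Let zariski_openT : zariski_open setT.
Proof.
exists setT; apply/seteqP; split=> // p _ /(_ 1 I).
by rewrite idealr1.
Qed.

Let zariski_openI : setI_closed zariski_open.
Proof.
move=> _ _ [S ->] [S' ->].
exists [set r | exists s s', [/\ S s, S' s' & r = s * s']].
apply/seteqP; split=> [p [hS hS'] h|p h].
  apply: hS => s Ss; apply: contrapT => /negP sp; apply: hS' => s' Ss'.
  have: s * s' \in (p : prime_idealr R) by apply: h; exists s, s'.
  by rewrite prime_idealrM (negPf sp).
split=> hS; apply: h => _ [s [s' [Ss Ss' ->]]]; rewrite prime_idealrM.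
  by rewrite hS.
by rewrite (hS s') // orbT.
Qed.

Let zariski_open_bigU (I : Type) (f : I -> set (Spec R)) :
  (forall i, zariski_open (f i)) -> zariski_open (\bigcup_i f i).
Proof.
move=> /choice [S fS]; exists (\bigcup_i S i).
rewrite (eq_bigcupr (fun i _ => fS i)) -setC_bigcap; congr (~` _).
apply/seteqP; split=> [p h r [i _ Sr]|p h i _ r Sr]; first exact: (h i).
by apply: h; exists i.
Qed.

HB.instance Definition _ := isOpenTopological.Build (Spec R)
  zariski_openT zariski_openI zariski_open_bigU.

(* [set_type] (inserted by coercion) carries the subspace topology. *)
Definition closed_points : Type := [set p : Spec R | closed [set p]].

HB.instance Definition _ := Topological.on closed_points.

Definition ideal_of (m : closed_points) : prime_idealr R := \val m.

End Zariski.

Section Fiber.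
Variables (R : comNzRingType) (A : pzRingType) (alpha : alg_structure R A).
Variable m : closed_points R.

Definition ideal_ext : {pred A} := fun x =>
  `[< exists2 s : seq (R * A), all (fun p => p.1 \in ideal_of m) s &
        x = \sum_(p <- s) alpha p.1 * p.2 >].

Let ideal_extP x : reflect
  (exists2 s : seq (R * A), all (fun p => p.1 \in ideal_of m) s &
     x = \sum_(p <- s) alpha p.1 * p.2) (x \in ideal_ext).
Proof. exact: asboolP. Qed.

Let ideal_ext_zmod : zmod_closed ideal_ext.
Proof.
split=> [|x y /ideal_extP[s ms ->] /ideal_extP[s' ms' ->]].
  by apply/ideal_extP; exists [::]; rewrite ?big_nil.
apply/ideal_extP; exists (s ++ [seq (p.1, - p.2) | p <- s']).
  by rewrite all_cat ms all_map.
rewrite big_cat big_map /= -sumrN; congr (_ + _).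
by apply: eq_bigr => p _; rewrite mulrN.
Qed.

HB.instance Definition _ := GRing.isZmodClosed.Build A ideal_ext ideal_ext_zmod.

Let ideal_extMl a x : x \in ideal_ext -> a * x \in ideal_ext.
Proof.
move=> /ideal_extP[s ms ->]; apply/ideal_extP.
exists [seq (p.1, a * p.2) | p <- s]; first by rewrite all_map.
rewrite big_map mulr_sumr; apply: eq_bigr => p _ /=.
by rewrite !mulrA alg_central.
Qed.

Let ideal_extMr a x : x \in ideal_ext -> x * a \in ideal_ext.
Proof.
move=> /ideal_extP[s ms ->]; apply/ideal_extP.
exists [seq (p.1, p.2 * a) | p <- s]; first by rewrite all_map.
by rewrite big_map mulr_suml; apply: eq_bigr => p _; rewrite mulrA.
Qed.

(* A / m A.  [Quotient.quot] is already an additive group, but MathComp puts a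
   multiplication on it only for commutative rings. *)
Definition fiber : Type := Quotient.quot ideal_ext.
HB.instance Definition _ := GRing.Zmodule.on fiber.

Definition to_fiber (x : A) : fiber := \pi_(Quotient.quot ideal_ext) x.
Let lift (u : fiber) : A := repr (u : Quotient.quot ideal_ext).

Let fone : fiber := to_fiber 1.
Let fmul (u v : fiber) : fiber := to_fiber (lift u * lift v).

Let liftK u : to_fiber (lift u) = u.
Proof. exact: reprK. Qed.

Lemma to_fiber_eq x y : to_fiber x = to_fiber y <-> x - y \in ideal_ext.
Proof. by rewrite /to_fiber Quotient.idealrBE; split=> [->|/eqP]. Qed.

Lemma to_fiberD x y : to_fiber (x + y) = to_fiber x + to_fiber y.
Proof. exact: (raddfD (\pi_(Quotient.quot ideal_ext))). Qed.

Let fmulE x y : fmul (to_fiber x) (to_fiber y) = to_fiber (x * y).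
Proof.
rewrite /fmul; set x' := lift _; set y' := lift _.
have hx : x' - x \in ideal_ext by apply/to_fiber_eq; rewrite liftK.
have hy : y' - y \in ideal_ext by apply/to_fiber_eq; rewrite liftK.
apply/to_fiber_eq.
have -> : x' * y' - x * y = x' * (y' - y) + (x' - x) * y.
  by rewrite mulrBr mulrBl addrA addrNK.
by apply: rpredD; [exact: ideal_extMl|exact: ideal_extMr].
Qed.

Let fmulA : associative fmul.
Proof.
by move=> u v w; rewrite -[u]liftK -[v]liftK -[w]liftK !fmulE mulrA.
Qed.
Let fmul1 : left_id fone fmul.
Proof. by move=> u; rewrite -[u]liftK fmulE mul1r. Qed.
Let fmulr1 : right_id fone fmul.
Proof. by move=> u; rewrite -[u]liftK fmulE mulr1. Qed.
Let fmulDl : left_distributive fmul +%R.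
Proof.
move=> u v w; rewrite -[u]liftK -[v]liftK -[w]liftK.
by rewrite -to_fiberD !fmulE -to_fiberD mulrDl.
Qed.
Let fmulDr : right_distributive fmul +%R.
Proof.
move=> u v w; rewrite -[u]liftK -[v]liftK -[w]liftK.
by rewrite -to_fiberD !fmulE -to_fiberD mulrDr.
Qed.

HB.instance Definition _ := GRing.Zmodule_isPzRing.Build fiber
  fmulA fmul1 fmulr1 fmulDl fmulDr.

Lemma to_fiber1 : to_fiber 1 = 1.
Proof. by []. Qed.

Lemma to_fiberM x y : to_fiber (x * y) = to_fiber x * to_fiber y.
Proof. by rewrite -fmulE. Qed.

End Fiber.

Section Blocks.
Variable B : pzRingType.

Definition central_idempotent (c : B) :=
  c * c = c /\ forall x, GRing.comm c x.

Definition centrally_primitive (c : B) :=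
  [/\ central_idempotent c, c <> 0 &
      forall c1 c2, central_idempotent c1 -> central_idempotent c2 ->
        c1 * c2 = 0 -> c = c1 + c2 -> c1 = 0 \/ c2 = 0].

Definition Bl : set B := [set c | centrally_primitive c].

(* [fset_set] sends infinite sets to the empty set. *)
Definition nblocks : nat := #|` fset_set Bl|%fset.

End Blocks.

Arguments Bl B : clear implicits.
Arguments nblocks B : clear implicits.

Section Strata.
Variable X : topologicalType.

Definition lower_semicontinuous_nat (f : X -> nat) :=
  forall n, closed [set x | (f x <= n)%N].

Definition locally_closed (S : set X) :=
  exists U C : set X, [/\ open U, closed C & S = U `&` C].

Definition stratification (F : nat -> set X) :=
  [/\ \bigcup_n F n = setT, trivIset setT F,
      forall n, locally_closed (F n) &
      forall n, closure (F n) `<=` \bigcup_(m in [set m | (m <= n)%N]) F m].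

End Strata.

(* Main.v *)
(* Let [m0] be a closed point. As [A] is flat, elements of [A] that lift a
   basis of the fiber at [m0] are a basis of every fiber over a
   neighbourhood. Choose [b] in [A] acting on the blocks of the fiber at
   [m0] by distinct scalars, and let [chi] be the characteristic polynomial
   of left multiplication by [b]. The roots of [chi] at [m0] are grouped
   according to the blocks. For a root enumeration of [chi] at another
   closed point, grouped in the same way, let [h_i] be the product of the [X
   - t] over the roots [t] in group [i] and [q_i] the product over the other
   roots, both evaluated at [b]. If the map [x |-> q_i x q_i + h_i x h_i] is
   injective, then [q_i (q_i + h_i)^-1] is a central idempotent, and for
   different [i] these are orthogonal. Injectivity and [q_i <> 0] amount to
   the nonvanishing of a polynomial in the roots of [chi], and the closed
   points over which some enumeration of the roots avoids the zeros of a
   given polynomial form an open set. Hence there are at least as many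
   blocks near [m0] as at [m0].

   Residue fields are [k] by the Nullstellensatz, obtained by extending
   [k]-valued points along the adjunction of one generator at a time. *)

Require Import Defs.
From mathcomp Require Import all_boot all_order all_algebra.
From mathcomp Require Import finmap boolp classical_sets cardinality topology.
From HB Require Import structures.
From mathcomp Require Import vector falgebra.

Set Implicit Arguments.
Unset Strict Implicit.
Unset Printing Implicit Defensive.

Import GRing.Theory.

Local Open Scope classical_set_scope.
Local Open Scope ring_scope.

(** It will provide polynomial relations of least degree, ideals of least dimension and shortest
    spanning families. *)
Lemma min_size (T : Type) (P : T -> Prop) (sz : T -> nat) :
  (exists x, P x) -> exists2 x, P x & forall y, P y -> (sz x <= sz y)%N.
Proof.
move=> [x0 Px0]; have ex : exists n, `[< exists2 x, P x & sz x = n >].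
  by exists (sz x0); apply/asboolP; exists x0.
case: (ex_minnP ex) => n /asboolP[x Px <-] xmin; exists x => // y Py.
by apply: xmin; apply/asboolP; exists y.
Qed.

(** * Closed points as evaluations *)

Section ExtendPoint.
Variables (k : closedFieldType) (D : idomainType) (K : comNzRingType).
Variables (j : {rmorphism D -> K}) (I : prime_idealr K) (x : K).

Let ev (g : {poly D}) : K := horner_morph (fun a => mulrC x (j a)) g.

Let evM g h : ev (g * h) = ev g * ev h. Proof. exact: rmorphM. Qed.
Let evD g h : ev (g + h) = ev g + ev h. Proof. exact: rmorphD. Qed.
Let evB g h : ev (g - h) = ev g - ev h. Proof. exact: rmorphB. Qed.
Let evC c : ev c%:P = j c. Proof. exact: horner_morphC. Qed.
Let evZ c g : ev (c *: g) = j c * ev g.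
Proof. by rewrite -mul_polyC evM evC. Qed.

Let null (g : {poly D}) := forall i, j g`_i \in I.

Let evn g : null g -> ev g \in I.
Proof.
move=> ng; rewrite /ev /horner_morph horner_coef rpred_sum // => i _.
by rewrite mulrC coef_map; apply/idealMr/ng.
Qed.

Let prime_exp c n : c \notin I -> c ^+ n \notin I.
Proof.
move=> cI; elim: n => [|n IH]; first by rewrite expr0 idealr1.
by rewrite exprS prime_idealrM negb_or cI.
Qed.

Let droplead (g : {poly D}) := g - lead_coef g *: 'X ^+ (size g).-1.

Let size_droplead g : g != 0 -> (size (droplead g) < size g)%N.
Proof.
move=> g0; rewrite -[X in (_ < X)%N]prednK ?size_poly_gt0 // ltnS.
apply/leq_sizeP => i; rewrite leq_eqVlt => /predU1P[<-|lti].
  by rewrite coefB coefZ coefXn eqxx mulr1 subrr.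
rewrite coefB coefZ coefXn gtn_eqF // mulr0 subr0 nth_default //.
by move: lti; case: (size g).
Qed.

Let ev_lead g : j (lead_coef g) \in I ->
  null (lead_coef g *: 'X ^+ (size g).-1).
Proof.
by move=> lI i; rewrite coefZ rmorphM mulrC; apply: idealMr.
Qed.

Let nullD g h : null g -> null h -> null (g + h).
Proof. by move=> ng nh i; rewrite coefD rmorphD rpredD. Qed.

Let nullM g h : null h -> null (g * h).
Proof.
move=> nh i; rewrite coefM rmorph_sum rpred_sum // => l _.
by rewrite rmorphM; apply/idealMr/nh.
Qed.

Let null_map (phi : {rmorphism D -> k}) g :
  (forall d, j d \in I -> phi d = 0) -> null g -> map_poly phi g = 0.
Proof.
by move=> kphi ng; apply/polyP => i; rewrite coef_map coef0; apply/kphi/ng.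
Qed.

(** Modulo [I], the element [x] is transcendental over the image of [D], or it satisfies a relation
    [p] of least degree. In the second case [xi] is a root of the image of [p], and [a] is the
    product of the leading coefficient of [p] and a constant that plays the role of the resultant of
    [p] and [b]. *)
Lemma extend_point (b : {poly D}) :
  ev b \notin I ->
  exists2 a, j a \notin I &
    forall phi : {rmorphism D -> k}, (forall d, j d \in I -> phi d = 0) ->
      phi a != 0 ->
    exists2 xi, forall g, ev g \in I -> (map_poly phi g).[xi] = 0 &
      (map_poly phi b).[xi] != 0.
Proof.
move=> bI.
have [transc|] := pselect (forall g, ev g \in I -> null g).
  have [i biI] : exists i, j b`_i \notin I.
    apply: contrapT => nb; move/negP: bI; apply; apply: evn => i.
    by apply: contrapT => /negP ?; apply: nb; exists i.
  exists b`_i => // phi kphi phib.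
  have : map_poly phi b != 0.
    by apply: contraNneq phib => /polyP/(_ i); rewrite coef_map coef0 => ->.
  move=> /closed_nonrootP[xi xiP]; exists xi => // g /transc ng.
  by rewrite (null_map kphi ng) horner0.
move=> /existsNP[p0 /not_implyP[p0I np0]].
have [p [pI np] pmin] := min_size (fun p : {poly D} => size p)
  (ex_intro (fun p => ev p \in I /\ ~ null p) p0 (conj p0I np0)).
have K1 r : ev r \in I -> (size r < size p)%N -> null r.
  move=> rI; rewrite ltnNge => /negP rp; apply: contrapT => nr.
  by apply: rp; apply: pmin.
have p_neq0 : p != 0 by apply/eqP => pE; apply: np => i;
  rewrite pE coef0 rmorph0 rpred0.
(* Otherwise removing the leading term of [p] would leave a shorter relation, null by minimality,
   and [p] itself would be null. *)
have lp : j (lead_coef p) \notin I.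
  apply/negP => lI; have := ev_lead lI => nl.
  have nd : null (droplead p).
    apply: K1; last exact: size_droplead.
    by rewrite evB rpredB // evn.
  by apply: np; rewrite -(subrK (lead_coef p *: 'X ^+ (size p).-1) p);
    apply: nullD.
have sp : (1 < size p)%N.
  rewrite ltnNge; apply/negP => /size1_polyC pE; apply: np => i.
  by rewrite pE coefC; case: eqP => _; rewrite ?rmorph0 ?rpred0 // -evC -pE.
(* In place of a resultant: up to null polynomials, the ideal generated by [p] and [b] contains a
   constant outside [I]. It is found as an element [c] of least size among those with [ev c] outside
   [I]. *)
pose form c := exists u v w, null w /\ c = u * p + v * b + w.
have [|c [cI cform] cmin] := min_size (fun c : {poly D} => size c)
  (P := fun c => ev c \notin I /\ form c).
  exists b; split=> //; exists 0, 1, 0; rewrite mul0r mul1r add0r addr0.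
  by split=> // i; rewrite coef0 rmorph0 rpred0.
have c_neq0 : c != 0 by apply/eqP => cE; rewrite cE /ev rmorph0 rpred0 in cI.
have lc : j (lead_coef c) \notin I.
  apply/negP => lI; have nl := ev_lead lI.
  have := size_droplead c_neq0; rewrite ltnNge => /negP; apply; apply: cmin.
  split.
    by rewrite evB; apply: contraNN cI => h;
      rewrite -(subrK (ev (lead_coef c *: 'X ^+ (size c).-1)) (ev c)) rpredD //
        evn.
  have [u [v [w [nw cE]]]] := cform.
  exists u, v, (w - lead_coef c *: 'X ^+ (size c).-1); split; last first.
    by rewrite /droplead {1}cE !addrA.
  by move=> i; rewrite coefB rmorphB rpredB.
have [u [v [w [nw cE]]]] := cform.
have divE (f g : {poly D}) := Pdiv.Idomain.divp_eq f g.
have scp : (size c < size p)%N.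
  rewrite ltnNge; apply/negP => pc.
  have rE := divE c p; have rI : ev (c %% p) \notin I.
    apply: contraNN cI => rI.
    have : ev (lead_coef p ^+ scalp c p *: c) \in I.
      by rewrite rE evD evM rpredD // idealMr.
    by rewrite evZ prime_idealrM rmorphXn /= (negPf (prime_exp _ lp)).
  have : (size c <= size (c %% p)%R)%N.
    apply: cmin; split=> //; set e := lead_coef p ^+ _ in rE.
    exists (e *: u - c %/ p), (e *: v), (e *: w); split.
      by move=> i; rewrite coefZ rmorphM idealMr.
    apply/(@addrI _ (c %/ p * p)); rewrite -rE [X in e *: X]cE.
    by rewrite !scalerDr mulrBl -!scalerAl !addrA [c %/ p * p + _ - _]addrAC
      subrr add0r.
  by rewrite leqNgt (leq_trans _ pc) // ltn_modp.
(* If [c] were not constant, the remainder of [p] by [c] would be shorter than [c], hence a relation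
   of [x], and then so would be the quotient. Both are shorter than [p], hence null, which makes [p]
   null. *)
have sc : (size c <= 1)%N.
  rewrite leqNgt; apply/negP => sc.
  have rE := divE p c; set e := lead_coef c ^+ _ in rE.
  have srem : (size (p %% c)%R < size c)%N by rewrite ltn_modp.
  have remI : ev (p %% c) \in I.
    apply: contraT => rI.
    suff: (size c <= size (p %% c)%R)%N by rewrite leqNgt srem.
    apply: cmin; split=> //.
    exists (e%:P - p %/ c * u), (- (p %/ c * v)), (- (p %/ c * w)); split.
      by move=> i; rewrite coefN rmorphN rpredN; apply: nullM.
    apply/(@addrI _ (p %/ c * c)); rewrite -rE -mul_polyC.
    rewrite [X in _ = _ * X + _]cE mulrBl !mulNr !mulrDr !mulrA.
    have addE (E X Y Z : {poly D}) : X + Y + Z + (E - X - Y - Z) = E.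
      by rewrite addrC -(addrA E) -opprD -(addrA E) -opprD subrK.
    by rewrite addE.
  have nrem : null (p %% c) by apply: K1 => //; apply: ltn_trans scp.
  have quoI : ev (p %/ c) \in I.
    have : ev (p %/ c * c) \in I.
      have -> : p %/ c * c = e *: p - p %% c by rewrite rE addrK.
      by rewrite evB evZ rpredB // idealMr.
    by rewrite evM prime_idealrM (negPf cI) orbF.
  have nquo : null (p %/ c).
    apply: K1 => //; rewrite size_divp //.
    by case: (size c) sc => [|[|n]] //= _;
      rewrite ltn_subrL /= (leq_trans _ sp).
  have nep : null (e *: p) by rewrite rE mulrC; apply: nullD => //;
    apply: nullM.
  apply: np => i; have := nep i; rewrite coefZ rmorphM prime_idealrM.
  by rewrite rmorphXn /= (negPf (prime_exp _ lc)).
have {sc}cC := size1_polyC sc; set ga := c`_0 in cC.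
have gaI : j ga \notin I by rewrite -evC -cC.
exists (lead_coef p * ga) => [|phi kphi].
  by rewrite rmorphM prime_idealrM negb_or lp.
rewrite rmorphM mulf_eq0 negb_or => /andP[philp phiga].
have smp : size (map_poly phi p) = size p by apply: size_poly_eq.
have /closed_rootP[xi /rootP xiP] : size (map_poly phi p) != 1%N.
  by rewrite smp; case: (size p) sp => [|[]].
(* Up to a power of the leading coefficient of [p], a relation [g] is a multiple of [p] plus a null
   remainder. If [b] vanished at [xi], so would the constant [c]. *)
exists xi => [g gI|].
  have rE := divE g p.
  have nrem : null (g %% p).
    apply: K1; last by rewrite ltn_modp.
    have -> : g %% p = lead_coef p ^+ scalp g p *: g - g %/ p * p
      by rewrite rE addrC addKr.
    by rewrite evB evZ evM rpredB // idealMr.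
  have /(congr1 (fun f => (map_poly phi f).[xi])) := rE.
  rewrite rmorphD rmorphM /= (null_map kphi nrem) addr0 hornerM xiP mulr0.
  rewrite linearZ /= hornerZ => /eqP;
    rewrite mulf_eq0 rmorphXn expf_eq0 (negPf philp) andbF.
  by move/eqP.
apply: contraNneq phiga => bxi.
have /(congr1 (fun f => (map_poly phi f).[xi])) := cE.
rewrite cC map_polyC hornerC !rmorphD !rmorphM /= (null_map kphi nw) addr0.
by rewrite hornerD !hornerM xiP bxi !mulr0 addr0 => ->.
Qed.

End ExtendPoint.

(** [D] is a polynomial ring over [k] with one variable for each member of [xs]; points are extended
    one variable at a time by [extend_point]. *)
Lemma adjoin_points (k : closedFieldType) (K : comNzRingType)
  (iota : {rmorphism k -> K}) (I : prime_idealr K) (xs : seq K) :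
  exists (D : idomainType) (j : {rmorphism D -> K}) (i0 : {rmorphism k -> D}),
  [/\ forall c, j (i0 c) = iota c, forall x, x \in xs -> exists d, j d = x &
    forall b, j b \notin I -> exists phi : {rmorphism D -> k},
      [/\ forall c, phi (i0 c) = c, forall d, j d \in I -> phi d = 0 &
          phi b != 0]].
Proof.
elim: xs => [|x xs [D [j [i0 [jE xsD IH]]]]].
  exists k, iota, (@idfun k); split=> // b bI; exists (@idfun k); split=> //=.
    move=> d; apply: contraTeq => d0; apply/negP => dI.
    have := idealMr (iota d^-1) dI.
    by rewrite -rmorphM mulVf // rmorph1 idealr1.
  by apply: contraNneq bI => ->; rewrite rmorph0 rpred0.
exists {poly D}, (horner_morph (fun a => mulrC x (j a))).
exists (polyC \o i0); split=> [c|y|b bI].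
- by rewrite /= horner_morphC.
- rewrite inE => /predU1P[->|/xsD[d <-]].
    by exists 'X; rewrite /= horner_morphX.
  by exists d%:P; rewrite /= horner_morphC.
have [a aI aP] := extend_point k bI.
have [phi [phiE kphi phia]] := IH a aI.
have [xi kxi bxi] := aP phi kphi phia.
exists (horner_morph (fun a => mulrC xi (phi a))); split=> // c.
by rewrite /= horner_morphC.
Qed.

Section ClosedPoints.
Variables (k : closedFieldType) (R : comNzRingType) (iota : {rmorphism k -> R}).
Hypothesis R_ft : finite_type iota.

(** A form of the weak Nullstellensatz. The generators of [R] are adjoined to [k], and the point of
    [D] obtained for [b = 1] descends along the surjection [j], since it kills the preimage of
    [I]. *)
Lemma prime_le_kernel (I : prime_idealr R) :
  exists psi : {rmorphism R -> k},
    (forall c, psi (iota c) = c) /\ forall r, r \in I -> psi r = 0.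
Proof.
have [n [x xP]] := R_ft.
have [D [j [i0 [jE xsD IH]]]] :=
  adjoin_points iota I [seq x i | i <- enum 'I_n].
have jsurj r : exists d, j d = r.
  have [p ->] := xP r; rewrite /mpoly.mmap.
  elim/big_ind: _ => [|u v [d <-] [d' <-]|m _]; first by exists 0;
    rewrite rmorph0.
    by exists (d + d'); rewrite rmorphD.
  have [d ->] : exists d, mpoly.mmap1 x m = j d.
    rewrite /mpoly.mmap1; elim/big_ind: _ => [|u v [d ->] [d' ->]|i _].
    - by exists 1; rewrite rmorph1.
    - by exists (d * d'); rewrite rmorphM.
    have [|d <-] := xsD (x i); first by rewrite map_f ?mem_enum.
    by eexists; rewrite -rmorphXn.
  by exists (i0 (mpoly.mcoeff m p) * d); rewrite rmorphM jE.
have [phi [phiE kphi _]] := IH 1 (eq_ind_r (fun z =>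
  z \notin I) (negbT (idealr1 I)) (rmorph1 j)).
pose lft r := projT1 (cid (jsurj r)).
have lftE r : j (lft r) = r by rewrite /lft; case: cid.
have phi_eq d d' : j d = j d' -> phi d = phi d'.
  move=> e; apply/eqP; rewrite -subr_eq0 -rmorphB; apply/eqP/kphi.
  by rewrite rmorphB e subrr rpred0.
pose psi r := phi (lft r).
have psiE d : psi (j d) = phi d by apply: phi_eq; rewrite lftE.
have psiB : zmod_morphism psi.
  by move=> r s; rewrite -(lftE r) -(lftE s) -rmorphB !psiE rmorphB.
have psiM : monoid_morphism psi.
  split=> [|r s]; first by rewrite -(rmorph1 j) psiE rmorph1.
  by rewrite -(lftE r) -(lftE s) -rmorphM !psiE rmorphM.
pose p1 := GRing.isZmodMorphism.Build R k psi psiB.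
pose p2 := GRing.isMonoidMorphism.Build R k psi psiM.
pose Psi : {rmorphism R -> k} := HB.pack psi p1 p2.
exists Psi; split=> [c|r rI] /=; first by rewrite -jE psiE phiE.
by apply: kphi; rewrite lftE.
Qed.

(** The kernel of a point vanishing on [m] is a prime containing [m]. A closed singleton is a zero
    locus, which contains every larger prime, so this kernel is [m]. *)
Lemma closed_point_eval (m : closed_points R) :
  exists psi : {rmorphism R -> k},
    (forall c, psi (iota c) = c) /\
    forall r, (r \in ideal_of m) = (psi r == 0).
Proof.
have [psi [psiE kpsi]] := prime_le_kernel (ideal_of m).
exists psi; split=> // r.
pose Q : {pred R} := fun r => psi r == 0.
have Qid : idealr_closed Q.
  split; rewrite ?unfold_in /= ?rmorph0 ?rmorph1 ?oner_eq0 //.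
  move=> a u v; rewrite !unfold_in /Q => /eqP u0 /eqP v0.
  by rewrite rmorphD rmorphM u0 v0 mulr0 addr0.
have Qpr : prime_idealr_closed Q.
  by move=> u v; rewrite !unfold_in /Q rmorphM mulf_eq0.
pose q1 := isIdealr.Build R Q Qid.
pose q2 := isPrimeIdealrClosed.Build R Q Qpr.
pose QQ : prime_idealr R := HB.pack (Q : R -> bool) q1 q2.
have mcl : closed [set ideal_of m : Spec R] by have := valP m; rewrite inE.
have [S SE] : zariski_open (~` [set ideal_of m : Spec R]).
  by move: mcl; rewrite -openC.
have {}SE : [set ideal_of m : Spec R] = zero_locus S.
  by rewrite -[LHS]setCK SE setCK.
have mS : zero_locus S (ideal_of m) by rewrite -SE.
have : zero_locus S (QQ : Spec R).
  by move=> s Ss; rewrite unfold_in /= /Q kpsi //; apply: mS.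
by rewrite -SE => QE; have {}QE : QQ = ideal_of m := QE; rewrite -QE.
Qed.

End ClosedPoints.

(** * Adjoining the roots of a monic polynomial *)

Lemma dvdp_prod_roots (k : fieldType) (g : {poly k}) (s : seq k) :
  (forall z, z \in s -> root g z) ->
  \prod_(z <- s) ('X - z%:P) %| g ^+ size s.
Proof.
elim: s => [|z s IHs] gs; first by rewrite big_nil dvd1p.
rewrite big_cons exprS dvdp_mul //.
  by rewrite dvdp_XsubCl gs ?mem_head.
by apply: IHs => y ys; rewrite gs // in_cons ys orbT.
Qed.

(* [g] vanishes at every root of [chi] exactly when [chi] divides a power of
   [g]. *)
Lemma root_avoid_open (k : closedFieldType) (D : comNzRingType)
  (chi g : {poly D}) (phi0 : {rmorphism D -> k}) (xi0 : k) :
  chi \is monic -> root (map_poly phi0 chi) xi0 ->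
  (map_poly phi0 g).[xi0] != 0 ->
  exists2 f, phi0 f != 0 &
    forall phi : {rmorphism D -> k}, phi f != 0 ->
      exists2 xi, root (map_poly phi chi) xi & (map_poly phi g).[xi] != 0.
Proof.
move=> mchi /rootP xi0P g0; set n := (size chi).-1.
(* The exponent is the degree of [chi], enough for all multiplicities: wherever [g] vanishes at all
   roots of [chi], the remainder [r] vanishes. At [phi0] it does not. *)
pose r := Pdiv.Ring.rmodp (g ^+ n) chi.
have rE : g ^+ n = Pdiv.Ring.rdivp (g ^+ n) chi * chi + r.
  exact: Pdiv.RingMonic.rdivp_eq.
have [i ri] : exists i, phi0 r`_i != 0.
  apply: contrapT => nr; have : map_poly phi0 r = 0.
    apply/polyP => i; rewrite coef_map coef0; apply: contrapT => /eqP ?.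
    by apply: nr; exists i.
  move=> r0; have /(congr1 (fun f => (map_poly phi0 f).[xi0])) := rE.
  rewrite rmorphD rmorphM rmorphXn /= r0 addr0 hornerM xi0P mulr0 horner_exp.
  by move/eqP; rewrite expf_eq0 (negPf g0) andbF.
exists r`_i => // phi phir; apply: contrapT => nxi.
have mphi : map_poly phi chi \is monic by exact: monic_map.
have [t tE] := closed_field_poly_normal (map_poly phi chi).
rewrite (monicP mphi) scale1r in tE.
have st : size t = n.
  by rewrite /n -(size_map_poly_id0 (f :=
    phi)) ?(monicP mchi) ?rmorph1 ?oner_eq0 // tE size_prod_XsubC.
have : map_poly phi chi %| map_poly phi r.
  have : map_poly phi chi %| map_poly phi g ^+ n.
    rewrite tE -st dvdp_prod_roots // => z zt; apply: contrapT => /negP gz.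
    by apply: nxi; exists z; rewrite // tE root_prod_XsubC.
  rewrite -rmorphXn /= rE rmorphD rmorphM /= dvdp_addr //.
  exact: dvdp_mull.
move=> /dvdp_leq dvd; move/eqP: phir; apply; rewrite -coef_map.
have [->|/dvd] := eqVneq (map_poly phi r) 0; first by rewrite coef0.
rewrite leqNgt => /negP []; apply: leq_ltn_trans (size_poly _ _) _.
rewrite (size_map_poly_id0 (f := phi)) ?(monicP mchi) ?rmorph1 ?oner_eq0 //.
by rewrite Pdiv.Ring.ltn_rmodpN0 // monic_neq0.
Qed.

(** [D'] is a polynomial ring with one variable for each root and no relation imposed; that [tau]
    splits [chi] is a condition on points. Openness follows by eliminating one root at a time with
    [root_avoid_open]. *)
Lemma universal_splitting (k : closedFieldType) (d : nat) (D : comNzRingType)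
  (chi : {poly D}) : chi \is monic -> size chi = d.+1 ->
  exists (D' : comNzRingType) (i : {rmorphism D -> D'}) (tau : seq D'),
  [/\ size tau = d,
   forall (phi : {rmorphism D -> k}) (t : seq k),
     map_poly phi chi = \prod_(z <- t) ('X - z%:P) ->
     exists2 phi' : {rmorphism D' -> k},
       phi' \o i =1 phi & map phi' tau = t &
   forall (s : D') (phi0 : {rmorphism D -> k}) (phi0' : {rmorphism D' -> k}),
     phi0' \o i =1 phi0 ->
     map_poly phi0 chi = \prod_(z <- map phi0' tau) ('X - z%:P) ->
     phi0' s != 0 ->
   exists2 f, phi0 f != 0 &
     forall phi : {rmorphism D -> k}, phi f != 0 ->
     exists phi' : {rmorphism D' -> k},
       [/\ phi' \o i =1 phi,
           map_poly phi chi = \prod_(z <- map phi' tau) ('X - z%:P) &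
           phi' s != 0]].
Proof.
elim: d D chi => [|d IHd] D chi mchi schi.
  have chi1 : chi = 1.
    by have /size1_polyC cE := eq_leq schi; move: mchi;
      rewrite cE monicE lead_coefC => /eqP->.
  exists D, (@idfun D), [::]; split=> // [phi t|s phi0 phi0' e _ s0].
    rewrite chi1 rmorph1 => /(congr1 (fun p : {poly k} => size p)).
    by rewrite size_prod_XsubC size_poly1 => -[] /esym/size0nil->; exists phi.
  exists s; first by rewrite -e.
  by move=> phi phis; exists phi; split=> //; rewrite chi1 rmorph1 big_nil.
(* Dividing [chi(Y) - chi(X)] by [Y - X] gives a monic [q] over [D[X]] of degree one less. Wherever
   [X] goes to a root of [chi], [q] becomes [chi] with that root removed. *)
have : root (map_poly polyC chi - chi%:P) 'X.
  by rewrite rootE hornerD hornerN hornerC -/(comp_poly 'X chi) comp_polyXr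
    subrr.
case/factor_theorem => q qE.
have cE : map_poly polyC chi = q * ('X - 'X%:P) + chi%:P by rewrite -qE subrK.
have schiP : size (map_poly polyC chi) = d.+2.
  by rewrite size_map_inj_poly //; exact: polyC_inj.
have lt_chi : (size (- chi%:P : {poly {poly D}}) < size (map_poly polyC chi))%N.
  by rewrite schiP size_polyN (leq_ltn_trans (size_polyC_leq1 _)).
have mq : q \is monic.
  have : q * ('X - 'X%:P) \is monic.
    by rewrite -qE monicE lead_coefDl // -monicE monic_map.
  by rewrite monicMr // monicXsubC.
have sq : size q = d.+1.
  have := size_Mmonic (monic_neq0 mq) (monicXsubC ('X : {poly D})).
  by rewrite -qE size_XsubC addn2 (size_polyDl lt_chi) schiP => -[].
have [D' [i' [tau' [stau IHa IHb]]]] := IHd _ q mq sq.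
pose i : {rmorphism D -> D'} := i' \o polyC.
have evE (phi1 : {rmorphism {poly D} -> k}) (phi : {rmorphism D -> k}) g :
    phi1 \o polyC =1 phi -> phi1 g = (map_poly phi g).[phi1 'X].
  move=> e; elim/poly_ind: g => [|g c IHg]; first by rewrite !rmorph0 horner0.
  rewrite !rmorphD !rmorphM /= map_polyX map_polyC hornerMXaddC -IHg.
  by congr (_ + _); exact: e.
have chiE (phi1 : {rmorphism {poly D} -> k}) (phi : {rmorphism D -> k}) :
    phi1 \o polyC =1 phi ->
    map_poly phi chi = map_poly phi1 q * ('X - (phi1 'X)%:P) + ((map_poly phi
      chi).[phi1 'X])%:P.
  move=> e; rewrite -(evE _ _ _ e) -map_polyC -(map_polyX phi1) -(map_polyC
    phi1) -rmorphB -rmorphM -rmorphD.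
  by rewrite /= -cE -map_poly_comp; apply: eq_map_poly.
exists D', i, (i' 'X :: tau'); split=> [|phi t tE|s phi0 phi0' e0 chi0 s0].
- by rewrite /= stau.
- case: t tE => [|xi t] tE.
    have := congr1 (fun p : {poly k} => size p) tE.
    by rewrite big_nil size_poly1 (size_map_poly_id0 (f :=
      phi)) ?(monicP mchi) ?rmorph1 ?oner_eq0 // schi.
  pose phi1 : {rmorphism {poly D} -> k} := horner_morph (fun a =>
    mulrC xi (phi a)).
  have e : phi1 \o polyC =1 phi by move=> a; rewrite /= horner_morphC.
  have X1 : phi1 'X = xi by rewrite /= horner_morphX.
  have := chiE _ _ e; rewrite X1 tE big_cons hornerM hornerXsubC subrr mul0r.
  rewrite addr0 mulrC => /mulIf; rewrite polyXsubC_eq0 => /(_ isT)/esym.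
  case/IHa => phi' e' tE'; exists phi' => [a|]; first by apply: etrans (e a);
    exact: e'.
  by rewrite /= tE'; congr (_ :: _); rewrite -X1; exact: e'.
pose phi01 : {rmorphism {poly D} -> k} := phi0' \o i'.
have {}e0 : phi01 \o polyC =1 phi0 := e0.
have rt0 : root (map_poly phi0 chi) (phi01 'X).
  by rewrite chi0 root_prod_XsubC mem_head.
have chi01 : map_poly phi01 q = \prod_(z <- map phi0' tau') ('X - z%:P).
  have := chiE _ _ e0; rewrite (rootP rt0) addr0 chi0 big_cons mulrC.
  by move=> /mulIf; rewrite polyXsubC_eq0 => /(_ isT)/esym.
(* Openness for [q] over [D[X]] gives [f1]; [root_avoid_open] brings it down to [D] by finding a
   root [xi] at which [f1] does not vanish. *)
have [f1 f10 f1P] := IHb s phi01 phi0' (fun=> erefl) chi01 s0.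
rewrite (evE _ _ _ e0) in f10.
have [f f0 fP] := root_avoid_open mchi rt0 f10.
exists f => // phi /fP[xi /rootP rxi f1xi].
pose phi1 : {rmorphism {poly D} -> k} := horner_morph (fun a =>
  mulrC xi (phi a)).
have e : phi1 \o polyC =1 phi by move=> a; rewrite /= horner_morphC.
have X1 : phi1 'X = xi by rewrite /= horner_morphX.
have [phi' [e' qP s1]] := f1P phi1 f1xi.
exists phi'; split=> // [a|]; first by apply: etrans (e a); exact: e'.
rewrite (chiE _ _ e) X1 rxi addr0 qP /= big_cons mulrC; congr (('X - _%:P) * _).
by rewrite -X1; apply/esym; exact: e'.
Qed.

(** * Blocks of finite-dimensional algebras *)

Section CentralIdempotents.
Variable B : pzRingType.
Implicit Types c e : B.

Lemma central_idempotentM c e : central_idempotent c -> central_idempotent e ->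
  central_idempotent (c * e).
Proof.
move=> [cc cC] [ee eC]; split=> [|x].
  by rewrite -mulrA [e * _]mulrA -(cC e) -[c * e * e]mulrA ee mulrA cc.
by rewrite /GRing.comm -mulrA eC mulrA cC mulrA.
Qed.

Lemma central_idempotentB1 c : central_idempotent c ->
  central_idempotent (1 - c).
Proof.
move=> [cc cC]; split=> [|x].
  by rewrite mulrBl mulrBr mulr1 mul1r mulrBr mulr1 cc subrr subr0.
by rewrite /GRing.comm mulrBl mulrBr mul1r mulr1 cC.
Qed.

Lemma central_idempotentD c e : central_idempotent c -> central_idempotent e ->
  c * e = 0 -> central_idempotent (c + e).
Proof.
move=> [cc cC] [ee eC] ce; split=> [|x].
  by rewrite mulrDl !mulrDr cc ee ce addr0 -(cC e) ce add0r.
by rewrite /GRing.comm mulrDl mulrDr cC eC.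
Qed.

(** Primitivity of [c], applied to [c = c e + c (1 - e)], makes [c e] equal to 0 or [c]; by symmetry
    it is 0 or [e]. *)
Lemma Bl_mul c e : Bl B c -> Bl B e -> c <> e -> c * e = 0.
Proof.
have split0 c' e' : Bl B c' -> Bl B e' -> c' * e' = 0 \/ c' = c' * e'.
  move=> [ci _ cP] [ei _ _].
  have [||||->|/eqP] := cP (c' * e') (c' * (1 - e')); auto.
  - exact: central_idempotentM.
  - exact/central_idempotentM/central_idempotentB1.
  - rewrite -mulrA [e' * _]mulrA -(ci.2 e') -[c' * e' * _]mulrA mulrBr mulr1.
    by rewrite ei.1 subrr !mulr0.
  - by rewrite -mulrDr addrC subrK mulr1.
  by rewrite mulrBr mulr1 subr_eq0 => /eqP <-; right.
move=> cB eB ce; have [[_ eC] _ _] := eB; have [//|cE] := split0 _ _ cB eB.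
have [eE|eE] := split0 _ _ eB cB; first by rewrite -(eC c).
by case: ce; rewrite cE -(eC c) -eE.
Qed.

End CentralIdempotents.

Section FinDimBlocks.
Variables (K : fieldType) (B : falgType K).

(** Such idempotents are linearly independent: multiplying a relation by one of them isolates its
    coefficient. *)
Lemma size_orthogonal_idempotents (s : seq B) : uniq s ->
  {in s, forall e, e * e = e /\ e <> 0} ->
  {in s &, forall e e', e <> e' -> e * e' = 0} -> (size s <= \dim {:B})%N.
Proof.
move=> us sid sorth; suff /eqP<- : free s by rewrite dimvS ?subvf.
apply/(@freeP _ _ _ (in_tuple s)) => l l0 i.
have si : s`_i \in s by apply: mem_nth.
have [sii si0] := sid _ si.
have /eqP : s`_i * \sum_(j < size s) l j *: (in_tuple s)`_j = 0.
  by rewrite l0 mulr0.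
rewrite mulr_sumr (bigD1 i) //= big1 ?addr0 => [|j ji].
  rewrite -scalerAr sii scaler_eq0 => /orP[/eqP //|/eqP si00].
  by case: si0.
rewrite -scalerAr sorth ?scaler0 ?mem_nth // => /eqP.
by rewrite nth_uniq // eq_sym; apply/negP.
Qed.

Lemma finite_Bl : finite_set (Bl B).
Proof.
apply: contrapT => /(@infinite_set_fset _ _ (\dim {:B}).+1)[F FB].
rewrite leqNgt => /negP; apply; rewrite ltnS.
apply: size_orthogonal_idempotents => [|e eF|e e' eF e'F].
- exact: fset_uniq.
- by have [[? _] ? _] := FB e eF; split.
by apply: Bl_mul; apply: FB.
Qed.

(** Among the nonzero central idempotents below [e], one whose ideal [c B] has least dimension is
    primitive: if [c = c1 + c2] with [c1] nonzero, then [c1 B = c B] contains [c2], which is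
    orthogonal to [c1] and so zero. *)
Lemma central_idempotent_block (e : B) : central_idempotent e -> e <> 0 ->
  exists2 c, Bl B c & c * e = c.
Proof.
move=> ei e0; pose P (c : B) := [/\ central_idempotent c, c <> 0 & c * e = c].
have [|c [ci c0 ce] cmin] := @min_size _ P (fun c => \dim (limg (amull c))).
  by exists e; split=> //; exact: ei.1.
exists c => //; split=> // c1 c2 c1i c2i c12 cE.
apply: contrapT => /not_orP[c10 c20].
have cc1 : c * c1 = c1 by rewrite cE mulrDl c1i.1 -(c1i.2 c2) c12 addr0.
have c1c : c1 * c = c1 by rewrite -(ci.2 c1).
have c1P : P c1 by split=> //; rewrite -c1c -mulrA ce.
have le1 : (limg (amull c1) <= limg (amull c))%VS.
  apply/subvP => _ /memv_imgP[x _ ->]; apply/memv_imgP; exists (c1 * x) => //.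
    exact: memvf.
  by rewrite !lfunE /= mulrA cc1.
have /eqP e12 : limg (amull c1) == limg (amull c) by rewrite eqEdim le1 cmin.
have : c2 \in limg (amull c1).
  rewrite e12; apply/memv_imgP; exists c2; first exact: memvf.
  by rewrite lfunE /= cE mulrDl c12 c2i.1 add0r.
move=> /memv_imgP[y _]; rewrite lfunE /= => c2E; apply: c20.
by rewrite -c2i.1 {2}c2E mulrA -(c1i.2 c2) c12 mul0r.
Qed.

Lemma nblocks_ge (N : nat) (e : 'I_N -> B) :
  (forall i, central_idempotent (e i)) -> (forall i, e i <> 0) ->
  (forall i j, i != j -> e i * e j = 0) -> (N <= nblocks B)%N.
Proof.
move=> ei e0 eij.
have /choice[c cP] : forall i, exists c, Bl B c /\ c * e i = c.
  by move=> i; have [c ? ?] := central_idempotent_block (ei i) (e0 i); exists c.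
have c_inj : injective c.
  move=> i j cij; apply: contrapT => /eqP /eij eij0.
  have [[_ c0 _] ci] := cP i; have [_ cj] := cP j.
  by apply: c0; rewrite -ci cij -cj -cij -mulrA -(ei i).2 eij0 mulr0.
have <- : size [seq c i | i <- enum 'I_N] = N
  by rewrite size_map -cardE card_ord.
apply: uniq_leq_size; first by rewrite map_inj_uniq ?enum_uniq.
move=> _ /mapP[i _ ->]; rewrite in_fset_set; last exact: finite_Bl.
by rewrite inE; exact: (cP i).1.
Qed.

Lemma block_enum : exists s : seq B,
  [/\ uniq s, size s = nblocks B, forall c, c \in s <-> Bl B c &
      \sum_(c <- s) c = 1].
Proof.
exists (enum_fset (fset_set (Bl B))).
have sP c : c \in enum_fset (fset_set (Bl B)) <-> Bl B c.
  by rewrite in_fset_set ?inE //; exact: finite_Bl.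
split=> //; first exact: fset_uniq.
set s := enum_fset _ in sP *; have us : uniq s by exact: fset_uniq.
have cis (t : seq B) : {subset t <= s} -> uniq t ->
    central_idempotent (\sum_(c <- t) c) /\
    forall c, Bl B c -> c \notin t -> c * \sum_(c <- t) c = 0.
  elim: t => [|c t IHt] ts /=.
    rewrite big_nil; split=> [|*]; rewrite ?mulr0 //.
    by split=> [|x]; rewrite /GRing.comm ?mulr0 ?mul0r.
  move=> /andP[ct ut]; rewrite big_cons.
  have [||ti tP] := IHt => //; first by move=> x xt; apply: ts;
    rewrite inE xt orbT.
  have cB : Bl B c by apply/sP/ts; rewrite mem_head.
  split; first by apply: central_idempotentD => //; [by case: cB|exact: tP].
  move=> x xB; rewrite inE negb_or => /andP[xc xt].
  by rewrite mulrDr tP // addr0; apply: Bl_mul => //; apply/eqP.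
have [] := cis s (fun _ => id) us; set S := \sum_(c <- s) c => Si _.
(* A block below [1 - S] would be one of the summands of [S], hence killed by [1 - S]. *)
apply: contrapT => S1.
have [|c cB cS] := central_idempotent_block (central_idempotentB1 Si).
  by move/eqP; rewrite subr_eq0 eq_sym => /eqP.
have [[cc _] c0 _] := cB; apply: c0.
rewrite -cS mulrBr mulr1 /S (bigD1_seq c) //=; last exact/sP.
rewrite mulrDr cc mulr_sumr big_seq_cond big1 ?addr0 ?subrr //.
move=> x /andP[/sP xB xc].
by apply: Bl_mul => //; apply/eqP; rewrite eq_sym.
Qed.

(* With [u = q + h], the injective map turns out to be [x |-> u x u], and the
   idempotent is [q u^-1]. *)
Lemma split_central_idempotent (q h : B) : q * h = 0 -> h * q = 0 ->
  (forall x, q * x * q + h * x * h = 0 -> x = 0) ->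
  exists v u, central_idempotent (q * v) /\ q * v * u = q.
Proof.
move=> qh hq inj.
have qxh x : q * x * h = 0.
  apply: inj; rewrite !mulrA hq !mul0r addr0.
  by rewrite -!mulrA hq !mulr0.
have hxq x : h * x * q = 0.
  apply: inj; rewrite !mulrA qh !mul0r add0r.
  by rewrite -!mulrA qh !mulr0.
pose u := q + h.
have u_inj x : u * x = 0 -> x = 0.
  move=> ux; apply: inj; have : u * x * u = 0 by rewrite ux mul0r.
  by rewrite /u !mulrDl !mulrDr qxh hxq addr0 add0r.
have ker0 : lker (amull u) == 0%VS.
  apply/lker0P => x y; rewrite !lfunE /= => /eqP.
  by rewrite -subr_eq0 -mulrBr => /eqP/u_inj/eqP; rewrite subr_eq0 => /eqP.
pose v := (amull u)^-1%VF 1.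
have uv : u * v = 1 by have := lker0_lfunVK ker0 1; rewrite lfunE.
have vu : v * u = 1.
  apply/eqP; rewrite -subr_eq0; apply/eqP/u_inj.
  by rewrite mulrBr mulrA uv mul1r mulr1 subrr.
(* Both sides equal [q * x * q], as the mixed terms vanish. Multiplying by [v] on both sides then
   leads to the centrality of [q * v]. *)
have qxu x : q * x * u = u * x * q.
  by rewrite /u mulrDr qxh addr0 !mulrDl hxq addr0.
have vqx x : v * q * x = x * q * v.
  have := congr1 (fun z => v * z * v) (qxu x).
  by rewrite !mulrA vu mul1r -[v * q * x * u * v]mulrA uv mulr1.
have vq : v * q = q * v by have := vqx 1; rewrite mulr1 mul1r.
exists v, u; split; last by rewrite -mulrA vu mulr1.
split=> [|x]; last by rewrite /GRing.comm -{1}vq vqx mulrA.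
have qq : q * q = q * u by rewrite /u mulrDr qh addr0.
by rewrite mulrA -[q * v * q]mulrA vq mulrA qq -[q * u * v]mulrA uv mulr1.
Qed.

Lemma nblocks_ge_split (N : nat) (q h : 'I_N -> B) :
  (forall i, q i * h i = 0) -> (forall i, h i * q i = 0) ->
  (forall i x, q i * x * q i + h i * x * h i = 0 -> x = 0) ->
  (forall i j, i != j -> q i * q j = 0) -> (forall i, q i <> 0) ->
  (N <= nblocks B)%N.
Proof.
move=> qh hq inj qij q0.
have /choice[v vP] i :
    exists v, exists u, central_idempotent (q i * v) /\ q i * v * u = q i.
  exact: split_central_idempotent (qh i) (hq i) (inj i).
apply: (@nblocks_ge _ (fun i => q i * v i)) => [i|i qv0|i j ij].
- by have [? []] := vP i.
- by have [u [_ qE]] := vP i; apply: (q0 i); rewrite -qE qv0 mul0r.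
have [u [ci _]] := vP i.
by rewrite mulrA ci.2 mulrA qij ?mul0r // eq_sym.
Qed.

End FinDimBlocks.

(** Roots are selected by their position in [t], not by their value, so that one grouping serves the
    root enumerations at all points. *)
Definition root_part (T : comNzRingType) (t : seq T) (P : pred nat) : {poly T}
  :=
  \prod_(j < size t | P j) ('X - (t`_j)%:P).

Lemma root_partC (T : comNzRingType) (t : seq T) (P : pred nat) :
  root_part t (predC P) * root_part t P = \prod_(z <- t) ('X - z%:P).
Proof. by rewrite (big_nth 0) big_mkord mulrC [RHS](bigID (fun j : 'I__ =>
  P j)). Qed.

Lemma dvdp_root_part (K : fieldType) (t : seq K) (P Q : pred nat) :
  (forall j, P j -> Q j) -> root_part t P %| root_part t Q.
Proof.
move=> PQ; rewrite {2}/root_part (bigID (fun j : 'I__ => P j)) /=.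
apply: dvdp_mulr; rewrite (eq_bigl (fun j : 'I__ => P j)) // => j.
by apply: andb_idl; exact: PQ.
Qed.

Lemma map_root_part (T T' : comNzRingType) (f : {rmorphism T -> T'}) (t : seq T)
  (P : pred nat) : map_poly f (root_part t P) = root_part (map f t) P.
Proof.
rewrite /root_part rmorph_prod size_map; apply: eq_bigr => j _ /=.
by rewrite rmorphB /= map_polyX map_polyC /= (nth_map 0).
Qed.

Lemma root_root_part (K : fieldType) (t : seq K) (P : pred nat) (z : K) :
  root (root_part t P) z <-> exists2 j, (j < size t)%N && P j & t`_j = z.
Proof.
rewrite /root_part rootE horner_prod; split=> [/prodf_eq0|].
  by move=> [j Pj]; rewrite hornerXsubC subr_eq0 => /eqP->; exists j;
    rewrite ?ltn_ord.
move=> [j /andP[jt Pj] <-]; apply/prodf_eq0; exists (Ordinal jt) => //.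
by rewrite hornerXsubC subrr.
Qed.

(** * Two-sided multiplication in coordinates *)

Section MatrixModel.
Variables (K : fieldType) (B : falgType K) (d : nat) (a : 'I_d.+1 -> B).
Let crd (x : 'rV[K]_d.+1) : B := \sum_j x 0 j *: a j.
Hypotheses (crd_inj : forall x, crd x = 0 -> x = 0).
Hypotheses (crd_surj : forall y, exists x, y = crd x).
Variables (b : B) (M N : 'M[K]_d.+1).
Hypothesis bL : forall j, b * a j = \sum_l M j l *: a l.
Hypothesis bR : forall j, a j * b = \sum_l N j l *: a l.

Let crdD x y : crd (x + y) = crd x + crd y.
Proof. by rewrite -big_split; apply: eq_bigr => j _; rewrite mxE scalerDl. Qed.

Let crdZ l x : crd (l *: x) = l *: crd x.
Proof. by rewrite scaler_sumr; apply: eq_bigr => j _; rewrite mxE scalerA. Qed.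

Let crd0 : crd 0 = 0.
Proof. by apply: big1 => j _; rewrite mxE scale0r. Qed.

Let crdM (A : 'M[K]_d.+1) x :
  crd (x *m A) = \sum_j x 0 j *: (\sum_l A j l *: a l).
Proof.
under [RHS]eq_bigr do rewrite scaler_sumr.
rewrite exchange_big; apply: eq_bigr => l _ /=.
rewrite mxE scaler_suml; apply: eq_bigr => j _; by rewrite scalerA.
Qed.

Let crdL p x : horner_alg b p * crd x = crd (x *m horner_mx M p).
Proof.
have crdb y : b * crd y = crd (y *m M).
  by rewrite crdM mulr_sumr; apply: eq_bigr => j _; rewrite -scalerAr bL.
elim/poly_ind: p x => [|p c IHp] x; first by rewrite !rmorph0 mul0r mulmx0 crd0.
rewrite !rmorphD !rmorphM /= horner_algX horner_mx_X horner_algC horner_mx_C.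
rewrite mulrDl mulmxDr crdD mul_mx_scalar crdZ mulr_algl.
have -> : horner_mx M p * M = M * horner_mx M p.
  by rewrite -{2 3}(horner_mx_X M) -!rmorphM mulrC.
by rewrite -mulrA crdb IHp -mulmxE mulmxA.
Qed.

Let crdR p x : crd x * horner_alg b p = crd (x *m horner_mx N p).
Proof.
have crdb y : crd y * b = crd (y *m N).
  by rewrite crdM mulr_suml; apply: eq_bigr => j _; rewrite -scalerAl bR.
elim/poly_ind: p x => [|p c IHp] x; first by rewrite !rmorph0 mulr0 mulmx0 crd0.
rewrite !rmorphD !rmorphM /= horner_algX horner_mx_X horner_algC horner_mx_C.
rewrite mulrDr mulmxDr crdD mulr_algr mul_mx_scalar crdZ.
by rewrite mulrA IHp crdb -mulmxA.
Qed.

Let horner_alg_char p : char_poly M %| p -> horner_alg b p = 0.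
Proof.
move=> /dvdpP[r ->]; have [x x1] := crd_surj 1.
by rewrite -[LHS]mulr1 x1 crdL rmorphM /= Cayley_Hamilton mulr0 mulmx0 crd0.
Qed.

(** The matrix of [y |-> p(b) y p(b)], acting on row vectors of coordinates. *)
Let split_mx (p : {poly K}) := horner_mx M p *m horner_mx N p.

Let crd_split p x :
  crd (x *m split_mx p) = horner_alg b p * crd x * horner_alg b p.
Proof. by rewrite crdL crdR mulmxA. Qed.

(** The conditions of [nblocks_ge_split] become divisibilities and nonvanishing of determinants and
    matrices, which can be carried from one fiber to another. Divisibility by the characteristic
    polynomial gives vanishing at [b] by Cayley-Hamilton. *)
Lemma nblocks_ge_mx (n : nat) (q h : 'I_n -> {poly K}) :
  (forall i, char_poly M %| q i * h i) ->
  (forall i j, i != j -> char_poly M %| q i * q j) ->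
  (forall i, \det (split_mx (q i) + split_mx (h i)) != 0) ->
  (forall i, horner_mx M (q i) != 0) -> (n <= nblocks B)%N.
Proof.
move=> qh qij inj q0.
apply: (@nblocks_ge_split _ _ _ (fun i => horner_alg b (q i))
  (fun i => horner_alg b (h i))) => [i|i|i y|i j ij|i qi0].
- by rewrite -rmorphM /= horner_alg_char.
- by rewrite -rmorphM mulrC /= horner_alg_char.
- have [x ->] := crd_surj y; rewrite -!crd_split -crdD -mulmxDr => /crd_inj x0.
  apply: contrapT => /eqP nx; move/negP: (inj i); apply; apply/det0P;
    exists x => //.
  by apply: contraNneq nx => ->; rewrite crd0.
- by rewrite -rmorphM /= horner_alg_char // qij.
move/eqP: (q0 i); apply; apply/row_matrixP => j.
by rewrite row0; apply: crd_inj; rewrite rowE -crdL qi0 mul0r.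
Qed.

Lemma horner_alg_eigen (y : B) c p : b * y = c *: y ->
  horner_alg b p * y = p.[c] *: y.
Proof.
move=> by_; elim/poly_ind: p => [|p e IHp];
  first by rewrite rmorph0 horner0 mul0r scale0r.
rewrite rmorphD rmorphM /= horner_algX horner_algC mulrDl mulr_algl -mulrA by_.
by rewrite -scalerAr IHp hornerMXaddC scalerDl scalerA mulrC.
Qed.

(** On block [l], [p(b)] acts as the scalar [p(c_l)], so [y |-> q(b) y q(b) + h(b) y h(b)] acts as
    [q(c_l)^2 + h(c_l)^2]. Exactly one of the two values is nonzero: [h(c_l)] vanishes for [l = i]
    only, and [q(c_l)] for all other [l]. *)
Lemma block_split_mx (s : seq B) (c t : seq K) (i : nat) :
  uniq s -> (forall e, e \in s <-> Bl B e) -> \sum_(e <- s) e = 1 ->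
  uniq c -> size c = size s -> b = \sum_(l < size s) c`_l *: s`_l ->
  char_poly M = \prod_(z <- t) ('X - z%:P) -> (i < size s)%N ->
  let h := root_part t (fun j => index t`_j c == i) in
  let q := root_part t (predC (fun j => index t`_j c == i)) in
  \det (split_mx q + split_mx h) != 0 /\ horner_mx M q != 0.
Proof.
move=> us sB s1 uc scs bE tE is_ h q.
have sE l : (l < size s)%N -> Bl B s`_l by move=> ls; apply/sB/mem_nth.
have b_s l : (l < size s)%N -> b * s`_l = c`_l *: s`_l.
  move=> ls; rewrite bE mulr_suml (bigD1 (Ordinal ls)) //= big1 ?addr0 =>
    [|j jl].
    by have [[e2 _] _ _] := sE l ls; rewrite -scalerAl e2.
  rewrite -scalerAl Bl_mul ?scaler0 //; [exact: sE|exact: sE|move=> /eqP].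
  by rewrite nth_uniq // => /eqP jlE; move/eqP: jl; apply; apply: val_inj.
have pb p l : (l < size s)%N -> horner_alg b p * s`_l = p.[c`_l] *: s`_l.
  by move=> ls; apply/horner_alg_eigen/b_s.
have s_neq0 l : (l < size s)%N -> s`_l <> 0 by move=> ls; have [] := sE l ls.
have comp0 y : (forall l, (l < size s)%N -> s`_l * y = 0) -> y = 0.
  move=> y0; rewrite -[y]mul1r -s1 mulr_suml big_seq big1 // => e es.
  by rewrite -(nth_index 0 es) y0 // index_mem.
(* The coordinates of block [l] form an eigenvector of [M] for [c_l], which therefore occurs among
   the roots [t]. *)
have c_t l : (l < size s)%N -> exists2 j, (j < size t)%N & t`_j = c`_l.
  move=> ls; have [v vE] := crd_surj s`_l.
  have : eigenvalue M c`_l.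
    apply/eigenvalueP; exists v; last first.
      by apply/eqP => v0; apply: (s_neq0 l ls); rewrite vE v0 crd0.
    apply/eqP; rewrite -subr_eq0; apply/eqP/crd_inj.
    rewrite -scaleN1r crdD !crdZ -{1}(horner_mx_X M) -crdL horner_algX -vE b_s
      //.
    by rewrite scaleN1r subrr.
  rewrite eigenvalue_root_char tE root_prod_XsubC => ct.
  by exists (index c`_l t); rewrite ?index_mem ?nth_index.
have hc l : (l < size s)%N -> (root h c`_l <-> l = i).
  move=> ls; split=> [/root_root_part[j /andP[jt /eqP jE] tc]|->].
    by rewrite -jE tc index_uniq // scs.
  by apply/root_root_part; have [j jt tj] := c_t i is_; exists j;
    rewrite // jt tj index_uniq ?eqxx // scs.
have qc l : (l < size s)%N -> (root q c`_l <-> l <> i).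
  move=> ls; split=> [/root_root_part[j /andP[jt /eqP jE] tc] li|li].
    by apply: jE; rewrite tc index_uniq // scs.
  apply/root_root_part; have [j jt tj] := c_t l ls; exists j;
    rewrite // jt /= tj index_uniq ?scs //.
  exact/eqP.
split; last first.
  apply/eqP => qM; have : horner_alg b q = 0.
    by have [x x1] := crd_surj 1; rewrite -[LHS]mulr1 x1 crdL qM mulmx0 crd0.
  move=> qb; have := pb q i is_; rewrite qb mul0r => /esym/eqP.
  rewrite scaler_eq0 => /orP[/(qc i is_)|/eqP/(s_neq0 i is_)] //.
apply/negP => /det0P[v v0 vs]; move/eqP: v0; apply; apply: crd_inj.
have := congr1 crd vs; rewrite mulmxDr crdD !crd_split crd0 => Deq.
apply: comp0 => l ls; have [[s2 sC] _ _] := sE l ls.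
have side p : s`_l * (horner_alg b p * crd v * horner_alg b p) = p.[c`_l] ^+ 2
  *: (s`_l * crd v).
  rewrite mulrA mulrA (sC (horner_alg b p)) pb // -!scalerAl -[s`_l * crd v *
    _]mulrA.
  by rewrite sC -mulrA pb // -scalerAr scalerA -expr2 sC.
have /eqP := congr1 (fun z => s`_l * z) Deq.
rewrite mulr0 mulrDr !side -scalerDl scaler_eq0 => /orP[|/eqP //] /eqP ql.
have [li|/eqP li] := eqVneq l i.
  have /rootP h0 : root h c`_l by apply/hc.
  move: ql; rewrite h0 expr0n addr0 => /eqP; rewrite sqrf_eq0.
  by move=> /(qc l ls); rewrite li.
have /rootP q0 : root q c`_l by apply/qc.
move: ql; rewrite q0 expr0n add0r => /eqP; rewrite sqrf_eq0.
by move=> /(hc l ls).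
Qed.

End MatrixModel.

(** * Algebras with a finite basis *)

Section FinDimAlg.
Variables (K : fieldType) (F : pzRingType) (beta : alg_structure K F).
Variables (d : nat) (a : 'I_d.+1 -> alg_module beta).
Hypothesis a_free : forall c : 'I_d.+1 -> K,
  \sum_i c i *: a i = 0 -> forall i, c i = 0.
Hypothesis a_span : forall y, exists c : 'I_d.+1 -> K, y = \sum_i c i *: a i.

(* The hypotheses are parameters of the type so that it carries the structures
   that they provide. *)
Definition fd_alg of (forall c : 'I_d.+1 -> K,
    \sum_i c i *: a i = 0 -> forall i, c i = 0) &
  (forall y, exists c : 'I_d.+1 -> K, y = \sum_i c i *: a i) : Type :=
  alg_module beta.

Local Notation B := (fd_alg a_free a_span).

HB.instance Definition _ := GRing.PzRing.on B.
HB.instance Definition _ := GRing.Lmodule.on B.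

Let fd_nz : (1 : B) != 0.
Proof.
apply/eqP => B10; have := @a_free (fun i => (i == ord0)%:R) _ ord0.
rewrite eqxx => h; suff /h/eqP : \sum_i (i == ord0)%:R *: a i = 0.
  by rewrite oner_eq0.
by rewrite -[LHS]mul1r [1 in LHS]B10 mul0r.
Qed.

HB.instance Definition _ := GRing.PzSemiRing_isNonZero.Build B fd_nz.

Let fd_scaleAl (l : K) (u v : B) : l *: (u * v) = l *: u * v.
Proof. by rewrite !alg_scaleE mulrA. Qed.

HB.instance Definition _ := GRing.Lmodule_isLalgebra.Build K B fd_scaleAl.

Let fd_scaleAr (l : K) (u v : B) : l *: (u * v) = u * (l *: v).
Proof. by rewrite !alg_scaleE !mulrA alg_central. Qed.

HB.instance Definition _ := GRing.Lalgebra_isAlgebra.Build K B fd_scaleAr.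

Let coords (y : B) : 'rV[K]_d.+1 := \row_i projT1 (cid (a_span y)) i.

Let coordsE (y : B) : y = \sum_i coords y 0 i *: a i.
Proof.
rewrite /coords; case: cid => c /= {1}->.
by apply: eq_bigr => i _; rewrite mxE.
Qed.

Let coords_uniq (y : B) (x : 'rV[K]_d.+1) :
  y = \sum_i x 0 i *: a i -> coords y = x.
Proof.
move=> yE; apply/rowP => i; apply/eqP; rewrite -subr_eq0; apply/eqP.
apply: (@a_free (fun i => coords y 0 i - x 0 i)).
under eq_bigr do rewrite scalerBl.
by rewrite sumrB -coordsE -yE subrr.
Qed.

Let coords_linear : linear coords.
Proof.
move=> l u v; apply: coords_uniq; rewrite {1}(coordsE u) {1}(coordsE v).
rewrite scaler_sumr -big_split; apply: eq_bigr => i _ /=.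
by rewrite !mxE scalerDl scalerA.
Qed.

Let coords_bij : bijective coords.
Proof.
exists (fun x : 'rV_d.+1 => \sum_i x 0 i *: a i : B) => [y|x];
  first by rewrite -coordsE.
exact: coords_uniq.
Qed.

HB.instance Definition _ := Lmodule_hasFinDim.Build K B
  (exist2 _ _ coords coords_linear coords_bij).
HB.instance Definition _ := Algebra_isFalgebra.Build K B.

End FinDimAlg.

(** The empty basis is treated apart because a [falgType] is a nonzero ring. *)
Lemma finite_Bl_basis (K : fieldType) (F : pzRingType) (beta : alg_structure K
  F)
  (d : nat) (a : 'I_d -> alg_module beta) :
  (forall c : 'I_d -> K, \sum_i c i *: a i = 0 -> forall i, c i = 0) ->
  (forall y, exists c : 'I_d -> K, y = \sum_i c i *: a i) ->
  finite_set (Bl F).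
Proof.
case: d a => [|d] a a_free a_span;
  last exact: (@finite_Bl K (fd_alg a_free a_span)).
have F0 (c : F) : c = 0 by have [? ->] := a_span c; rewrite big_ord0.
apply: (sub_finite_set (B := set0)) => // c [_ c0 _]; case: c0; exact: F0.
Qed.

(** * Finitely generated flat modules *)

Section QuotientModule.
Variables (R : comNzRingType) (V : lmodType R) (P : {pred V}).
Hypothesis P_closed : submod_closed P.

Let P_zmod : zmod_closed P. Proof. exact: GRing.submod_closedB P_closed. Qed.

HB.instance Definition _ := GRing.isZmodClosed.Build V P P_zmod.

Definition quot_module : Type := Quotient.quot P.
Local Notation Q := quot_module.

HB.instance Definition _ := GRing.Zmodule.on Q.

Definition to_quot (x : V) : Q := \pi_(Quotient.quot P)%qT x.

Lemma to_quot_eq x y : to_quot x = to_quot y <-> x - y \in P.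
Proof. by rewrite /to_quot Quotient.idealrBE; split=> [->|/eqP]. Qed.

Lemma to_quotD x y : to_quot (x + y) = to_quot x + to_quot y.
Proof. exact: (raddfD (\pi_(Quotient.quot P)%qT)). Qed.

Let lift (u : Q) : V := repr (u : Quotient.quot P).
Let liftK u : to_quot (lift u) = u. Proof. exact: reprK. Qed.

Let qscale (r : R) (u : Q) : Q := to_quot (r *: lift u).

Lemma qscaleE r x : qscale r (to_quot x) = to_quot (r *: x).
Proof.
apply/to_quot_eq; rewrite -scalerBr; have [P0 Plin] := P_closed.
rewrite -[_ *: _]addr0; apply: Plin => //.
by apply/to_quot_eq; rewrite liftK.
Qed.

Let qscaleA r s u : qscale r (qscale s u) = qscale (r * s) u.
Proof. by rewrite -[u]liftK !qscaleE scalerA. Qed.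
Let qscale1 : left_id 1 qscale.
Proof. by move=> u; rewrite -[u]liftK !qscaleE scale1r. Qed.
Let qscaleDr : right_distributive qscale +%R.
Proof.
move=> r u v; rewrite -[u]liftK -[v]liftK -to_quotD !qscaleE -to_quotD.
by rewrite scalerDr.
Qed.
Let qscaleDl u : {morph qscale^~ u : r s / r + s}.
Proof. by move=> r s; rewrite -[u]liftK !qscaleE -to_quotD scalerDl. Qed.

HB.instance Definition _ := GRing.Zmodule_isLmodule.Build R Q
  qscaleA qscale1 qscaleDr qscaleDl.

Lemma to_quotZ r x : to_quot (r *: x) = r *: to_quot x.
Proof. by rewrite -qscaleE. Qed.

End QuotientModule.

Section SubModule.
Variables (R : comNzRingType) (V : lmodType R) (P : {pred V}).
Hypothesis P_closed : submod_closed P.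

Record sub_module (H : submod_closed P) := SubMod {
  sub_val :> V;
  sub_valP : sub_val \in P
}.

Local Notation S := (sub_module P_closed).
HB.instance Definition _ := [isSub for @sub_val P_closed].
HB.instance Definition _ := [Choice of S by <:].
HB.instance Definition _ := GRing.SubChoice_isSubLmodule.Build R V _ S
  (GRing.submod_closed_semi P_closed).

Definition sub_incl : {linear S -> V} := \val.

Lemma sub_incl_inj : injective sub_incl. Proof. exact: val_inj. Qed.

Lemma sub_inclP x : sub_incl x \in P. Proof. exact: valP. Qed.

End SubModule.

(** A spanning family of least length is free, since a nontrivial relation would express one member
    through the others. *)
Lemma finite_basis (K : fieldType) (V : lmodType K) : finitely_generated V ->
  exists (d : nat) (v : 'I_d -> V),
    (forall c : 'I_d -> K, \sum_i c i *: v i = 0 -> forall i, c i = 0) /\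
    (forall y, exists c : 'I_d -> K, y = \sum_i c i *: v i).
Proof.
move=> [n [g gP]].
pose span (dv : {d & 'I_d -> V}) :=
  forall y, exists c : 'I_(tag dv) -> K, y = \sum_i c i *: tagged dv i.
have [|[d v] vspan vmin] := @min_size _ span (fun dv => tag dv).
  by exists (Tagged (fun d => 'I_d -> V) g).
exists d, v; split=> // c c0 i; apply: contrapT => /eqP ci.
case: d v vspan vmin c c0 i ci => [|d] v vspan vmin c c0 i ci;
  first by case: i ci.
suff /vmin : span (Tagged (fun d => 'I_d -> V) (fun l => v (lift i l))).
  by rewrite /= ltnn.
have splitE (e : 'I_d.+1 -> K) :
    \sum_j e j *: v j = e i *: v i + \sum_l e (lift i l) *: v (lift i l).
  exact: bigD1_ord.
have vi : v i = \sum_l (- (c i)^-1 * c (lift i l)) *: v (lift i l).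
  apply: (scalerI ci); rewrite scaler_sumr.
  move/eqP: c0; rewrite splitE addr_eq0 => /eqP->; rewrite -sumrN.
  apply: eq_bigr => l _; rewrite -scaleNr scalerA.
  by rewrite mulrA mulrN mulfV // mulN1r.
move=> y; have [e ->] := vspan y; rewrite /= splitE vi.
exists (fun l => e i * (- (c i)^-1 * c (lift i l)) + e (lift i l)).
rewrite scaler_sumr -big_split; apply: eq_bigr => l _ /=.
by rewrite scalerDl scalerA.
Qed.

(* Nakayama's lemma by the determinant trick, for the ideal [ker psi]. *)
Lemma nakayama (R K : comNzRingType) (psi : {rmorphism R -> K})
  (V : lmodType R) (n d : nat) (g : 'I_n -> V) (a : 'I_d -> V) :
  (forall i, exists (r : 'I_d -> R) (mu : 'I_n -> R),
     (forall l, psi (mu l) = 0) /\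
     g i = \sum_j r j *: a j + \sum_l mu l *: g l) ->
  exists f, psi f = 1 /\
    forall i, exists c : 'I_d -> R, f *: g i = \sum_j c j *: a j.
Proof.
move=> /choice[r /choice[mu gE]].
pose U : 'M[R]_n := \matrix_(i, l) ((i == l)%:R - mu i l).
have UE i : \sum_l U i l *: g l = \sum_j r i j *: a j.
  under eq_bigr do rewrite mxE scalerBl.
  rewrite sumrB (bigD1 i) //= eqxx scale1r big1 ?addr0; last first.
    by move=> l; rewrite eq_sym => /negPf->; rewrite scale0r.
  by rewrite {1}(gE i).2 addrK.
exists (\det U); split=> [|i].
  rewrite -det_map_mx; have -> : map_mx psi U = 1%:M.
    apply/matrixP => i l; rewrite !mxE rmorphB (gE i).1 subr0.
    by rewrite rmorph_nat.
  exact: det1.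
exists (fun j => \sum_p (\adj U) i p * r p j).
under [RHS]eq_bigr do rewrite scaler_suml.
rewrite exchange_big /=.
have -> : \det U *: g i = \sum_l (\adj U *m U) i l *: g l.
  rewrite mul_adj_mx (bigD1 i) //= big1 ?addr0;
    first by rewrite !mxE eqxx mulr1n.
  by move=> l li; rewrite !mxE eq_sym (negPf li) mulr0n scale0r.
under [LHS]eq_bigr => l _ do rewrite [(_ *m _) i l]mxE scaler_suml.
rewrite exchange_big /=; apply: eq_bigr => p _.
under eq_bigr do rewrite -scalerA.
rewrite -scaler_sumr UE scaler_sumr.
by apply: eq_bigr => j _; rewrite scalerA.
Qed.

Section FlatIndependence.
Variables (k : fieldType) (R : idomainType) (iota : {rmorphism k -> R}).
Variables (psi : {rmorphism R -> k}) (psiK : forall c, psi (iota c) = c).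
Variables (V : lmodType R) (V_flat : flat V).

(* If [r] is a relation between the [a i] and [I] is the ideal generated by the
   [r i], then [\sum_i a i (x) r i] vanishes in [V (x) I] by flatness; applying
   [kap i] to the first factor gives [I = (ker psi) I]. *)
Lemma flat_free_of_residue_free (d : nat) (a : 'I_d -> V) (kap : 'I_d -> V ->
  k) :
  (forall i, {morph kap i : x y / x + y}) ->
  (forall i r x, kap i (r *: x) = psi r * kap i x) ->
  (forall i j, kap i (a j) = (i == j)%:R) ->
  forall r : 'I_d -> R, \sum_i r i *: a i = 0 -> forall i, r i = 0.
Proof.
move=> kapD kapZ kapa r ra0.
pose I : {pred R^o} := fun x => `[< exists c : 'I_d ->
  R, x = \sum_l c l * r l >].
have I_closed : submod_closed I.
  split; first by apply/asboolP; exists (fun=> 0); rewrite big1 // => l _;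
    rewrite mul0r.
  move=> s x y /asboolP[c ->] /asboolP[e ->]; apply/asboolP.
  exists (fun l => s * c l + e l); rewrite scaler_sumr -big_split.
  by apply: eq_bigr => l _ /=; rewrite mulrDl -mulrA.
pose mI : {pred R^o} := fun x => `[< exists c : 'I_d -> R,
  (forall l, psi (c l) = 0) /\ x = \sum_l c l * r l >].
have mI_closed : submod_closed mI.
  split.
    apply/asboolP; exists (fun=> 0); split=> [l|]; first by rewrite rmorph0.
    by rewrite big1 // => l _; rewrite mul0r.
  move=> s x y /asboolP[c [c0 ->]] /asboolP[e [e0 ->]]; apply/asboolP.
  exists (fun l => s * c l + e l); split=> [l|].
    by rewrite rmorphD rmorphM c0 e0 mulr0 addr0.
  rewrite scaler_sumr -big_split.
  by apply: eq_bigr => l _ /=; rewrite mulrDl -mulrA.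
have mI_mul s x : psi s = 0 -> x \in I -> s * x \in mI.
  move=> s0 /asboolP[c ->]; apply/asboolP; exists (fun l => s * c l).
  split=> [l|]; first by rewrite rmorphM s0 mul0r.
  by rewrite mulr_sumr; apply: eq_bigr => l _; rewrite mulrA.
have rI i : r i \in I.
  apply/asboolP; exists (fun l => (l == i)%:R);
    rewrite (bigD1 i) //= eqxx mul1r.
  by rewrite big1 ?addr0 // => l /negPf->; rewrite mul0r.
pose N : lmodType R := sub_module I_closed.
pose rho i : N := SubMod I_closed (rI i).
pose incl : {linear N -> R^o} := sub_incl I_closed.
have inclP s x y : incl (s *: x + y) = s *: incl x + incl y by exact: linearP.
pose sc (x : V) (s : R^o) : V := s *: x.
have sc_bil : bilinear_for *:%R *:%R sc.
  split=> z s x y; rewrite /sc.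
    by rewrite /= scalerDr !scalerA mulrC.
  by rewrite /= scalerDl scalerA.
pose scB := bilinear_isBilinear.Build R V R^o V *:%R *:%R sc sc_bil.
pose SC : {bilinear V -> R^o -> V} := HB.pack sc scB.
(* [V] with its scalar multiplication is the tensor product of [V] and [R], so flatness along the
   inclusion of [I] in [R] makes multiplication injective on the tensor product of [V] and [I]. *)
have SC_tensor : is_tensor SC.
  move=> L b.
  pose G : {linear V -> L} := applyr b (1 : R^o).
  exists G; split=> [x s|h hE x].
    change (b (s *: x) (1 : R^o) = b x s); rewrite linearZl /= -linearZr /=.
    by congr (b _ _); exact: mulr1.
  change (h x = b x (1 : R^o)); rewrite -hE; congr (h _).
  by change (x = 1 *: x); rewrite scale1r.
pose sv (x : V) (y : N) : V := (incl y : R) *: x.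
have sv_bil : bilinear_for *:%R *:%R sv.
  split=> z s x y; rewrite /sv.
    by rewrite /= scalerDr !scalerA mulrC.
  transitivity ((s * incl x + incl y) *: z); first by congr (_ *: _);
    exact: inclP.
  by rewrite scalerDl -scalerA.
pose svB := bilinear_isBilinear.Build R V N V *:%R *:%R sv sv_bil.
pose SV : {bilinear V -> N -> V} := HB.pack sv svB.
have [g [gE _]] := tensorP SV.
have g_inj : injective g.
  apply: (V_flat (@tensorP R V N) SC_tensor (f := incl)) => //.
  exact: sub_incl_inj.
pose u : tensor V N := \sum_i tens (a i) (rho i).
have u0 : u = 0.
  apply: g_inj; rewrite linear0 linear_sum -[RHS]ra0.
  by apply: eq_bigr => i _; rewrite gE.
have rmI i : r i \in mI.
  (* The map [kap i] is linear only through [psi]. Modulo [mI] this is enough for bilinearity,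
     because [s - iota (psi s)] lies in [ker psi]. *)
  pose be (x : V) (y : N) : quot_module mI_closed :=
    to_quot mI_closed (iota (kap i x) * (incl y : R)).
  have be_bil : bilinear_for *:%R *:%R be.
    split=> z s x y; rewrite /= /be -to_quotZ -to_quotD; apply/to_quot_eq.
      rewrite kapD kapZ; set w := incl z.
      have -> : iota (psi s * kap i x + kap i y) * w -
          (s *: (iota (kap i x) * w : R^o) + iota (kap i y) * w) =
          (iota (psi s) - s) * iota (kap i x) * w.
        rewrite rmorphD rmorphM mulrDl opprD addrACA subrr addr0.
        by rewrite !mulrBl; congr (_ - _); exact: mulrA.
      apply: mI_mul; last exact: sub_inclP.
      by rewrite rmorphM rmorphB (psiK (psi s)) subrr mul0r.
    have -> : incl (s *: x + y) = s *: incl x + incl y by exact: inclP.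
    have distE (c p q : R) : c * (s * p + q) - (s * (c * p) + c * q) = 0.
      by rewrite mulrDr mulrCA subrr.
    suff -> : iota (kap i z) * (s *: incl x + incl y) -
        (s *: (iota (kap i z) * incl x : R^o) + iota (kap i z) * incl y) = 0.
      by have [] := mI_closed.
    exact: distE.
  pose beB := bilinear_isBilinear.Build R V N (quot_module mI_closed) *:%R *:%R
    be be_bil.
  pose BE : {bilinear V -> N -> quot_module mI_closed} := HB.pack be beB.
  have [G [GE _]] := tensorP BE.
  have : G u = 0 by rewrite u0 linear0.
  rewrite linear_sum (bigD1 i) //= big1 ?addr0; last first.
    move=> j ji; rewrite GE /= /be kapa eq_sym (negPf ji) rmorph0 mul0r.
    by rewrite -[RHS](scale0r (to_quot mI_closed 0)) -to_quotZ scale0r.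
  rewrite GE /= /be kapa eqxx rmorph1 mul1r.
  have -> : 0 = to_quot mI_closed 0
    by rewrite -[LHS](scale0r (to_quot mI_closed 0)) -to_quotZ scale0r.
  by move=> /to_quot_eq; rewrite subr0.
(* With an empty family [a], Nakayama's lemma gives an [f] outside [ker psi] that kills every [r i];
   [R] is a domain. *)
have [|f [f1 fP]] := @nakayama R k psi R^o d 0 r (fun _ => 0).
  move=> i; have /asboolP[c [c0 rE]] := rmI i.
  by exists (fun=> 0), c; rewrite big_ord0 add0r.
move=> i; have [c] := fP i; rewrite big_ord0.
move/eqP; change (f * r i == 0 -> r i = 0);
  rewrite mulf_eq0 => /orP[/eqP fE|/eqP //].
by move/eqP: f1; rewrite fE rmorph0 eq_sym oner_eq0.
Qed.

End FlatIndependence.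

(** * Fibers *)

Lemma closed_field_uniq_seq (k : closedFieldType) (n : nat) :
  exists s : seq k, uniq s /\ size s = n.
Proof.
elim: n => [|n [s [us ss]]]; first by exists [::].
have /closed_nonrootP[x] : \prod_(z <- s) ('X - z%:P) != 0.
  by apply/monic_neq0/monic_prod_XsubC.
by rewrite root_prod_XsubC => xs; exists (x :: s); rewrite /= xs us ss.
Qed.

Section FiberAlgebra.
Variables (k : closedFieldType) (R : idomainType) (iota : {rmorphism k -> R}).
Variables (A : pzRingType) (alpha : alg_structure R A).
Implicit Types m : closed_points R.

Let to_fiber_zmod m : zmod_morphism (to_fiber alpha m).
Proof.
move=> x y; apply/eqP; rewrite eq_sym subr_eq -to_fiberD subrK; exact/eqP.
Qed.

Let to_fiber_monoid m : monoid_morphism (to_fiber alpha m).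
Proof. by split=> [|x y]; rewrite ?to_fiberM ?to_fiber1. Qed.

HB.instance Definition _ m := GRing.isZmodMorphism.Build A (fiber alpha m)
  (to_fiber alpha m) (to_fiber_zmod m).
HB.instance Definition _ m := GRing.isMonoidMorphism.Build A (fiber alpha m)
  (to_fiber alpha m) (to_fiber_monoid m).

Lemma to_fiber_surj m (u : fiber alpha m) : exists x, to_fiber alpha m x = u.
Proof. by exists (repr (u : Quotient.quot (ideal_ext alpha m)));
  exact: reprK. Qed.

Let fiber_central m c (u : fiber alpha m) :
  (to_fiber alpha m \o alpha \o iota) c * u =
  u * (to_fiber alpha m \o alpha \o iota) c.
Proof.
by have [x <-] := to_fiber_surj u; rewrite /= -!to_fiberM alg_central.
Qed.

(** Scalars are taken in [k] through [iota], so that all fibers are algebras over the same field. *)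
Definition fiber_alg m : alg_structure k (fiber alpha m) :=
  AlgStructure (alg_morph :=
    to_fiber alpha m \o alpha \o iota) (@fiber_central m).

Definition fib m (x : A) : alg_module (fiber_alg m) := to_fiber alpha m x.

Lemma fib_surj m (u : alg_module (fiber_alg m)) : exists x, fib m x = u.
Proof. exact: to_fiber_surj. Qed.

Lemma fibD m x y : fib m (x + y) = fib m x + fib m y.
Proof. exact: rmorphD. Qed.

Lemma fibM m x y : fib m (x * y) = fib m x * fib m y.
Proof. exact: rmorphM. Qed.

Lemma fib0 m : fib m 0 = 0.
Proof. exact: rmorph0. Qed.

Lemma fib_sum m (I : finType) (F : I -> A) :
  fib m (\sum_i F i) = \sum_i fib m (F i).
Proof. exact: rmorph_sum. Qed.

Lemma fib_eq0 m x : fib m x = 0 <-> x \in ideal_ext alpha m.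
Proof.
by rewrite -(fib0 m); split=> [/to_fiber_eq|xm];
  [rewrite subr0|apply/to_fiber_eq; rewrite subr0].
Qed.

Definition point_of m (psi : {rmorphism R -> k}) :=
  (forall c, psi (iota c) = c) /\ forall r, (r \in ideal_of m) = (psi r == 0).

Lemma fibZ m psi r (x : alg_module alpha) : point_of m psi ->
  fib m (r *: x) = psi r *: fib m x.
Proof.
move=> [psiK kerE].
have -> : psi r *: fib m x = fib m (alpha (iota (psi r)) * (x : A))
  by rewrite fibM.
apply/to_fiber_eq; apply/asboolP.
exists [:: (r - iota (psi r), x : A)].
  by rewrite /= kerE rmorphB psiK subrr eqxx.
by rewrite big_seq1 /= rmorphB mulrBl.
Qed.

Lemma ideal_ext_gens m psi n (g : 'I_n -> alg_module alpha) : point_of m psi ->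
  (forall x, exists c : 'I_n -> R, x = \sum_i c i *: g i) ->
  forall x : A, x \in ideal_ext alpha m ->
  exists mu : 'I_n -> R, (forall l, psi (mu l) = 0) /\ x = \sum_l mu l *: g l.
Proof.
move=> [psiK kerE] gP x /asboolP[s ms ->]; elim: s ms => [|[r y] s IHs] /=.
  by exists (fun=> 0); split=> [l|];
    rewrite ?rmorph0 // big_nil big1 // => l _; rewrite scale0r.
move=> /andP[rm /IHs[mu [mu0 muE]]]; have [c yE] := gP y.
exists (fun l => r * c l + mu l); split=> [l|].
  by rewrite rmorphD rmorphM mu0 addr0; move: rm; rewrite kerE => /eqP->;
    rewrite mul0r.
rewrite big_cons muE /= -/(r *: (y : alg_module alpha)) yE.
under [RHS]eq_bigr do rewrite scalerDl -scalerA.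
by rewrite big_split /= -scaler_sumr.
Qed.

Hypothesis A_fg : finitely_generated (alg_module alpha).
Hypothesis A_flat : flat (alg_module alpha).

(** Lifts [a] of a basis at [m0] are free over [R] by flatness, and Nakayama's lemma gives [f] such
    that [f] times every element is a combination of them. Where [psi f] is nonzero it can be
    divided out, so the [a i] span the fiber; their independence is checked over [R] after
    multiplication by [f]. *)
Lemma local_basis m0 psi0 : point_of m0 psi0 ->
  exists (d : nat) (a : 'I_d -> alg_module alpha) (f : R),
  [/\ psi0 f != 0,
      forall x : alg_module alpha, exists c : 'I_d ->
        R, f *: x = \sum_i c i *: a i &
      forall m psi, point_of m psi -> psi f != 0 ->
        (forall c : 'I_d -> k, \sum_i c i *: fib m (a i) = 0 ->
          forall i, c i = 0) /\
        (forall y, exists c : 'I_d -> k, y = \sum_i c i *: fib m (a i))].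
Proof.
move=> p0; have [n [g gP]] := A_fg.
have [|d [v [v_free v_span]]] := @finite_basis k (alg_module (fiber_alg m0)).
  exists n, (fun i => fib m0 (g i)) => u; have [x <-] := fib_surj u.
  have [c ->] := gP x; exists (fun i => psi0 (c i)).
  by rewrite fib_sum; apply: eq_bigr => i _; rewrite (fibZ _ _ p0).
have /choice[a aE] : forall j, exists x : alg_module alpha, fib m0 x = v j.
  by move=> j; apply: fib_surj.
have /choice[kp kpE] : forall x : alg_module alpha, exists c : 'I_d -> k,
    fib m0 x = \sum_i c i *: v i.
  by move=> x; apply: v_span.
have kp_uniq x (c : 'I_d -> k) : fib m0 x = \sum_i c i *: v i ->
  forall i, kp x i = c i.
  move=> xE i; apply/eqP; rewrite -subr_eq0; apply/eqP.
  apply: (v_free (fun i => kp x i - c i)).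
  under eq_bigr do rewrite scalerBl.
  by rewrite sumrB -xE -kpE subrr.
have a_free : forall r : 'I_d -> R, \sum_i r i *: a i = 0 -> forall i, r i = 0.
  apply: (@flat_free_of_residue_free k R iota psi0 p0.1 _ A_flat d a (fun i x
    => kp x i)).
  - move=> i x y; apply: (kp_uniq _ (fun i => kp x i + kp y i)).
    rewrite fibD !kpE -big_split; apply: eq_bigr => j _ /=; by rewrite scalerDl.
  - move=> i r x; apply: (kp_uniq _ (fun i => psi0 r * kp x i)).
    by rewrite (fibZ _ _ p0) kpE scaler_sumr; apply: eq_bigr => j _;
      rewrite scalerA.
  move=> i j; apply: (kp_uniq _ (fun i => (i == j)%:R)).
  rewrite aE (bigD1 j) //= eqxx scale1r big1 ?addr0 // => l /negPf->.
  by rewrite scale0r.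
have [|f [f1 fP]] := @nakayama R k psi0 _ n d g a.
  move=> i; have : (g i - \sum_j iota (kp (g i) j) *: a j : A) \in ideal_ext
    alpha m0.
    apply/fib_eq0/eqP; rewrite fibD -scaleN1r; apply/eqP.
    rewrite (fibZ _ _ p0) fib_sum rmorphN1 scaleN1r kpE; apply/eqP.
    rewrite subr_eq0; apply/eqP/eq_bigr => j _.
    by rewrite (fibZ _ _ p0) p0.1 aE.
  move=> /(ideal_ext_gens p0 gP)[mu [mu0 muE]].
  exists (fun j => iota (kp (g i) j)), mu; split=> //.
  by rewrite -muE addrC subrK.
have {}fP x : exists c : 'I_d -> R, f *: x = \sum_j c j *: a j.
  have [r ->] := gP x; have /choice[c cE] := fP.
  exists (fun j => \sum_i r i * c i j); rewrite scaler_sumr.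
  under [RHS]eq_bigr do rewrite scaler_suml.
  rewrite exchange_big /=; apply: eq_bigr => i _.
  rewrite scalerA mulrC -scalerA cE scaler_sumr.
  by apply: eq_bigr => j _; rewrite scalerA.
exists d, a, f; split=> //; first by rewrite f1 oner_eq0.
move=> m psi pm psif; split=> [c c0 i|y].
  have : (\sum_i iota (c i) *: a i : A) \in ideal_ext alpha m.
    apply/fib_eq0; rewrite fib_sum -[RHS]c0; apply: eq_bigr => j _.
    by rewrite (fibZ _ _ pm) pm.1.
  move=> /(ideal_ext_gens pm gP)[mu [mu0 muE]].
  have /choice[e eE] l := fP (g l).
  (* The lifted relation lies in the extended ideal, so [f] times it is also a combination of the
     [a j] with coefficients in [ker psi]. Freeness over [R] compares the two expressions. *)
  have : \sum_j (f * iota (c j) - \sum_l mu l * e l j) *: a j = 0.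
    under eq_bigr do rewrite scalerBl.
    rewrite sumrB; apply/eqP; rewrite subr_eq0; apply/eqP.
    under eq_bigr do rewrite -scalerA.
    rewrite -scaler_sumr muE scaler_sumr.
    under [RHS]eq_bigr do rewrite scaler_suml.
    rewrite exchange_big /=; apply: eq_bigr => l _.
    rewrite scalerA mulrC -scalerA eE scaler_sumr.
    by apply: eq_bigr => j _; rewrite scalerA.
  move=> /a_free/(_ i)/(congr1 psi).
  rewrite rmorphB rmorphM pm.1 rmorph_sum rmorph0 big1 ?subr0; last first.
    by move=> l _; rewrite rmorphM mu0 mul0r.
  by move/eqP; rewrite mulf_eq0 (negPf psif) => /eqP.
have [x <-] := fib_surj y; have [c cE] := fP x.
exists (fun i => (psi f)^-1 * psi (c i)).
rewrite -[LHS]scale1r -(mulVf psif) -scalerA -(fibZ _ _ pm) cE fib_sum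
  scaler_sumr.
by apply: eq_bigr => j _; rewrite (fibZ _ _ pm) scalerA.
Qed.

End FiberAlgebra.

(** * Semicontinuity of the number of blocks *)

Section Semicontinuity.
Variables (k : closedFieldType) (R : idomainType) (iota : {rmorphism k -> R}).
Hypothesis R_ft : finite_type iota.
Variables (A : pzRingType) (alpha : alg_structure R A).
Hypothesis A_fg : finitely_generated (alg_module alpha).
Hypothesis A_flat : flat (alg_module alpha).
Implicit Types m : closed_points R.

Lemma finite_Bl_fiber m : finite_set (Bl (fiber alpha m)).
Proof.
have [psi pm] := closed_point_eval R_ft m.
have [d [a [f [f0 _ aP]]]] := local_basis A_fg A_flat pm.
have [a_free a_span] := aP _ _ pm f0.
exact: finite_Bl_basis a_free a_span.
Qed.

Lemma nblocks_fiber_near m0 :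
  exists2 f : R, f \notin ideal_of m0 &
    forall m, f \notin ideal_of m ->
      (nblocks (fiber alpha m0) <= nblocks (fiber alpha m))%N.
Proof.
have [psi0 pm0] := closed_point_eval R_ft m0.
have [d [a [f [f0 fP aP]]]] := local_basis A_fg A_flat pm0.
case: d a fP aP => [|d] a fP aP.
  exists f => [|m _]; first by rewrite pm0.2.
  have [_ a_span] := aP _ _ pm0 f0.
  have F0 (c : fiber alpha m0) : c = 0 by have [? ->] := a_span c;
    rewrite big_ord0.
  suff -> : nblocks (fiber alpha m0) = 0%N by [].
  have Bl0 : Bl (fiber alpha m0) = set0.
    by apply/seteqP; split=> // c [_ c0 _]; apply: c0; exact: F0.
  by rewrite /nblocks Bl0 fset_set0 cardfs0.
have [a_free0 a_span0] := aP _ _ pm0 f0.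
pose B0 : falgType k := fd_alg a_free0 a_span0.
have [s [us ss sP s1]] := block_enum B0.
have -> : nblocks (fiber alpha m0) = size s by rewrite ss.
have [c' [uc' sc']] := closed_field_uniq_seq k (size s).
(* The element [b] will be [f *: b'], since only [f] times an element of [A] is known to be a
   combination of the [a j]. At [m0] the scalars [c'] are multiplied by [psi0 f], which is nonzero,
   and stay distinct. *)
pose c := map (fun z => psi0 f * z) c'.
have uc : uniq c by rewrite map_inj_uniq //; exact: mulfI.
have sc : size c = size s by rewrite size_map.
have [b' b'E] := fib_surj (\sum_(l < size s) c'`_l *: (s`_l : B0) : alg_module
  (fiber_alg iota alpha m0)).
have /choice[Mf MfE] : forall j, exists e : 'I_d.+1 -> R,
  f *: (b' * (a j : A) : alg_module alpha) = \sum_l e l *: a l by move=> j;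
    apply: fP.
have /choice[Nf NfE] : forall j, exists e : 'I_d.+1 -> R,
  f *: ((a j : A) * b' : alg_module alpha) = \sum_l e l *: a l by move=> j;
    apply: fP.
pose M : 'M[R]_d.+1 := \matrix_(j, l) Mf j l.
pose N : 'M[R]_d.+1 := \matrix_(j, l) Nf j l.
pose b m := fib iota alpha m ((f *: (b' : alg_module alpha)) : A).
have bL m psi j : point_of iota m psi ->
    b m * fib iota alpha m (a j) = \sum_l (map_mx psi M) j l *: fib iota alpha
      m (a l).
  move=> pm; rewrite /b -fibM -[_ * _]/(alpha f * b' * (a j : A)) -mulrA.
  rewrite -[alpha f * _]/(f *: (b' * (a j : A) : alg_module alpha)) MfE fib_sum.
  by apply: eq_bigr => l _; rewrite (fibZ _ _ pm) !mxE.
have bR m psi j : point_of iota m psi ->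
    fib iota alpha m (a j) * b m = \sum_l (map_mx psi N) j l *: fib iota alpha
      m (a l).
  move=> pm; rewrite /b -fibM -[f *: _]/(alpha f * b') mulrA -alg_central
    -mulrA.
  rewrite -[alpha f * _]/(f *: ((a j : A) * b' : alg_module alpha)) NfE fib_sum.
  by apply: eq_bigr => l _; rewrite (fibZ _ _ pm) !mxE.
have chi_m : char_poly M \is monic := char_poly_monic M.
have [D' [i [tau [stau liftP openP]]]] :=
  universal_splitting k chi_m (size_char_poly M).
have [t0 t0E] := closed_field_poly_normal (map_poly psi0 (char_poly M)).
rewrite (monicP (monic_map psi0 chi_m)) scale1r in t0E.
have [phi0 phi0i phi0t] := liftP psi0 t0 t0E.
(* Position [j] belongs to group [l] when the root at that position over [m0] is the scalar of block
   [l]. The same positions are used over all other points. *)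
pose P l := fun j => index t0`_j c == l.
pose h l := root_part tau (P l).
pose q l := root_part tau (predC (P l)).
pose sp p := horner_mx (map_mx i M) p *m horner_mx (map_mx i N) p.
have evalE (phi : {rmorphism D' ->
  k}) psi (C : 'M[R]_d.+1) Q : phi \o i =1 psi ->
    map_mx phi (horner_mx (map_mx i C) (root_part tau Q)) =
    horner_mx (map_mx psi C) (root_part (map phi tau) Q).
  move=> phii; rewrite map_horner_mx map_root_part; congr horner_mx.
  by apply/matrixP => x y; rewrite !mxE; exact: phii.
have row_inj m (c1 : forall c : 'I_d.+1 -> k,
    \sum_i c i *: fib iota alpha m (a i) = 0 -> forall i, c i = 0)
    (x : 'rV[k]_d.+1) : \sum_j x 0 j *: fib iota alpha m (a j) = 0 -> x = 0.
  by move=> x0; apply/rowP => j; rewrite mxE; exact: (c1 (fun j => x 0 j)).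
have row_surj m (c2 : forall y, exists c : 'I_d.+1 -> k,
    y = \sum_i c i *: fib iota alpha m (a i)) y :
    exists x : 'rV[k]_d.+1, y = \sum_j x 0 j *: fib iota alpha m (a j).
  have [e ->] := c2 y; exists (\row_j e j).
  by apply: eq_bigr => j _; rewrite mxE.
have bE0 : b m0 = \sum_(l < size s) c`_l *: (s`_l : B0).
  rewrite /b (fibZ _ _ pm0) b'E scaler_sumr; apply: eq_bigr => l _.
  by rewrite scalerA (nth_map 0) // sc'.
have charE (psi : {rmorphism R ->
  k}) : char_poly (map_mx psi M) = map_poly psi (char_poly M).
  by rewrite map_char_poly.
have at0 (l : 'I_(size s)) := @block_split_mx _ B0 d _ (row_inj m0 a_free0)
  (row_surj m0 a_span0) (b m0 : B0) (map_mx psi0 M) (map_mx psi0 N)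
  (fun j => bL m0 psi0 j pm0) (fun j =>
    bR m0 psi0 j pm0) s c t0 l us sP s1 uc sc
  bE0 (etrans (charE psi0) t0E) (ltn_ord l).
(* Fixing a nonzero entry of each matrix [q_l(M)] at [m0] turns [q_l(M) <> 0] into the nonvanishing
   of one element of [D']. These entries and the determinants are multiplied together in [S]. *)
have /choice[xy xyP] (l : 'I_(size s)) : exists xy : 'I_d.+1 * 'I_d.+1,
    horner_mx (map_mx psi0 M) (root_part t0 (predC (P l))) xy.1 xy.2 != 0.
  have [_ qM] := at0 l; apply: contrapT => qM0; move/eqP: qM; apply.
  apply/matrixP => x y; rewrite !mxE; apply: contrapT => /eqP ?.
  by apply: qM0; exists (x, y).
pose S := \prod_(l < size s) (\det (sp (q l) + sp (h l)) *
  horner_mx (map_mx i M) (q l) (xy l).1 (xy l).2).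
have SE (phi : {rmorphism D' -> k}) (psi : {rmorphism R ->
  k}) : phi \o i =1 psi ->
    let t := map phi tau in
    phi S = \prod_(l < size s)
      (\det (horner_mx (map_mx psi M) (root_part t (predC (P l))) *m
             horner_mx (map_mx psi N) (root_part t (predC (P l))) +
             horner_mx (map_mx psi M) (root_part t (P l)) *m
             horner_mx (map_mx psi N) (root_part t (P l))) *
       horner_mx (map_mx psi M) (root_part t (predC (P l))) (xy l).1 (xy l).2).
  move=> phii t; rewrite rmorph_prod; apply: eq_bigr => l _.
  rewrite rmorphM -det_map_mx map_mxD !map_mxM /= !(evalE phi psi _ _ phii).
  by congr (_ * _); rewrite -(evalE phi psi M _ phii) mxE.
have S0 : phi0 S != 0.
  rewrite (SE _ _ phi0i) phi0t; apply/prodf_neq0 => l _.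
  by rewrite mulf_neq0 ?xyP //; have [] := at0 l.
have [|f1 f10 f1P] := openP S psi0 phi0 phi0i _ S0; first by rewrite phi0t.
(* [f] keeps the [a j] a basis of the fiber, and [f1] provides an enumeration of the roots at which
   [S] is nonzero. *)
exists (f * f1) => [|m]; first by rewrite pm0.2 rmorphM mulf_neq0.
have [psi pm] := closed_point_eval R_ft m.
rewrite pm.2 rmorphM mulf_eq0 negb_or => /andP[psif psif1].
have [a_free a_span] := aP _ _ pm psif.
have [phi [phii chiE phiS]] := f1P psi psif1.
rewrite (SE _ _ phii) in phiS; move/prodf_neq0: phiS => phiS.
set t := map phi tau in chiE phiS.
pose B : falgType k := fd_alg a_free a_span.
apply: (@nblocks_ge_mx _ B d _ (row_inj m a_free) (row_surj m a_span) (b m : B)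
  (map_mx psi M) (map_mx psi N) (fun j => bL m psi j pm) (fun j =>
    bR m psi j pm)
  _ (fun l => root_part t (predC (P l))) (fun l => root_part t (P l)))
  => [l|l l' ll'|l|l].
- by rewrite root_partC charE chiE.
(* For distinct [l] and [l'], group [l] lies in the complement of group [l'], so [h_l] divides
   [q_l'] and [chi = q_l h_l] divides [q_l q_l']. *)
- rewrite charE chiE -(root_partC t (P l)) dvdp_mul // dvdp_root_part // => j.
  by rewrite /P /= => /eqP->.
- by have := phiS l isT; rewrite mulf_eq0 negb_or => /andP[].
have := phiS l isT; rewrite mulf_eq0 negb_or => /andP[_].
by apply: contraNneq => ->; rewrite mxE.
Qed.

(** The complement of the sublevel set is the trace of a union of basic open sets [D f];
    [nblocks_fiber_near] provides one around each of its points. *)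
Lemma nblocks_fiber_lower_semicontinuous :
  lower_semicontinuous_nat (fun m => nblocks (fiber alpha m)).
Proof.
move=> n; rewrite -openC.
pose D (f : R) : set (Spec R) := ~` zero_locus [set f].
have D_open f : open (D f) by exists [set f].
have DE f m : D f (ideal_of m) <-> f \notin ideal_of m.
  split=> [Df|/negP fm Df]; last by apply: fm; apply: Df.
  by apply/negP => fm; apply: Df => _ ->.
pose near f := forall m, f \notin ideal_of m -> (n < nblocks (fiber alpha m))%N.
exists (\bigcup_(f in near) D f); first exact: bigcup_open.
apply/seteqP; split=> [m [f fn /DE fm]|m].
  by move=> /=; apply/negP; rewrite -ltnNge; apply: fn.
move=> /= /negP; rewrite -ltnNge => nm; have [f fm fP] := nblocks_fiber_near m.
exists f; last exact/DE.
by move=> m' fm'; apply: leq_trans nm (fP m' fm').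
Qed.

End Semicontinuity.

(** The piece of value [n] is the sublevel set of [n] minus that of [n - 1], with [n = 0] apart. Its
    closure stays in the closed sublevel set of [n]. *)
Lemma stratification_of_lower_semicontinuous (X : topologicalType) (F : X ->
  nat) :
  lower_semicontinuous_nat F -> stratification (fun n => [set x | F x = n]).
Proof.
move=> Flsc; split.
- by apply/seteqP; split=> // x _; exists (F x).
- by apply/trivIsetP => i j _ _ ij; apply/seteqP; split=> // x [/= -> /eqP];
  rewrite (negPf ij).
- case=> [|n].
    exists setT, [set x | (F x <= 0)%N]; split=> //; first exact: openT.
    apply/seteqP; split=> [x /= ->|x [_ /=]] //.
    by rewrite leqn0 => /eqP.
  exists (~` [set x | (F x <= n)%N]), [set x | (F x <= n.+1)%N]; split=> //.
    by rewrite openC.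
  apply/seteqP; split=> [x /= ->|x [/= /negP + Fn]]; first by split=> //;
    apply/negP; rewrite ltnn.
  by rewrite -ltnNge => nF; apply/eqP; rewrite eqn_leq Fn.
move=> n x xF; exists (F x) => //=.
have : closure [set x | (F x <= n)%N] x by apply: closureS xF => y /= ->.
by rewrite -(closure_id _).1 //; exact: Flsc.
Qed.

Theorem theorem1p6
  (k : closedFieldType) (R : idomainType) (iota : {rmorphism k -> R})
  (R_ft : finite_type iota)
  (A : pzRingType) (alpha : alg_structure R A)
  (A_fg : finitely_generated (alg_module alpha))
  (A_flat : flat (alg_module alpha)) :
  [/\ forall m : closed_points R, finite_set (Bl (fiber alpha m)),
      lower_semicontinuous_nat
        (fun m : closed_points R => nblocks (fiber alpha m)) &
      stratification
        (fun n => [set m : closed_points R | nblocks (fiber alpha m) = n])].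
Proof.
have lsc := nblocks_fiber_lower_semicontinuous R_ft A_fg A_flat.
split=> // [m|]; first exact: (finite_Bl_fiber R_ft A_fg A_flat m).
exact: stratification_of_lower_semicontinuous.
Qed.
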